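(* Let $a^*>1$. Then the interconnected network dynamics formed by $$H_1:\ \dot{x}=-\nabla_x f(x)+u_x+u_{H_1},\ \ \dot a_{iq}=d_{iq}(e_{iq}^Te_{iq}+\dot e_{iq}^T\dot e_{iq})\ (i\in\mathcal N,\,q\in\mathcal N_i),\ \ y_{H_1}=x;$$ $$H_2:\ \dot\alpha=u_{H_2},\ \ y_{H_2}=\alpha;\qquad H_3:\ \dot\theta^{ik}_j=[g_j(x_{ik})]^+_{\theta^{ik}_j},\ \ y_{H_3}=\Big(\sum_{j=1}^{m_g^{ik}}\theta^{ik}_j\nabla g_j(x_{ik})\Big)_{i,k};$$ with $u_{H_1}=-(L\otimes I_l)y_{H_2}-y_{H_3}$, $u_{H_2}=(L\otimes I_l)y_{H_1}$, $u_{H_3}=y_{H_1}$, is passive from the input $u_x=-(L\otimes I_l)x$ to the output $y_{H_1}$.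
   Context: Graph: $\mathcal G=(\mathcal N,\mathcal E)$ is an undirected connected graph, $\mathcal N=\{1,\dots,n\}$, $\mathcal N_i$ the neighbor set of $i$, with coupling weights $a_{iq}=a_{qi}>0$ for $(i,q)\in\mathcal E$ and $a_{iq}=0$ otherwise; $L$ is the weighted Laplacian, time-varying because the weights evolve. $d_{iq}=d_{qi}>0$ are adaptive gains, $e_{iq}=x_i-x_q$; the right-hand side of the weight law, as a function of $(e_{iq},\dot e_{iq})$, is assumed Lipschitz continuous. For scalars, $[a]^+_b:=a$ if $b>0$ or $a>0$, and $0$ otherwise. The dynamics is associated with the problem: minimize $f(x)=\sum_{i=1}^n f_i(x_i)$, $x_i=[x_{i1},\dots,x_{il}]^T\in\mathbb R^l$, $x=[x_1^T,\dots,x_n^T]^T\in\mathbb R^{ln}$, subject to $x_{ik}=x_{qk}$ for all $i,q\in\mathcal N$, $k=1,\dots,l$ and $g_j(x_{ik})\le0$ for $j=1,\dots,m_g^{ik}$, all $k$, $i$. The $f_i$ are twice differentiable and strongly convex, the $g_j:\mathbb R\to\mathbb R$ convex (and differentiable), and Slater's condition holds. It is assumed that $f$ is $\mu$-strongly convex and $\kappa$-smooth: $\mu\|x_1-x_2\|^2\le\langle\nabla f(x_1)-\nabla f(x_2),x_1-x_2\rangle\le\kappa\|x_1-x_2\|^2$ for all $x_1,x_2\in\mathbb R^{ln}$. Parameter $a^*$: a constant to be selected, entering the storage function of the weight law, $W=\frac12\sum_{i=1}^n\sum_{q=1}^n\frac1{d_{iq}}(a_{iq}-a^*_{iq})^2$,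 where $a^*_{iq}=a^*$ if $i$ and $q$ are neighbors and $a^*_{iq}=0$ otherwise (only neighboring pairs contribute). Passivity: a system with input $u$ and output $y$ is passive if there is a positive semidefinite, continuously differentiable storage function $V$ such that $\dot V\le u^Ty$ along trajectories. Storage functions of Krasovskii type (depending on the state through $\dot x,\dot\alpha,\dot\theta$) are allowed. *)

(* Defs.v *)
From HB Require Import structures.
From mathcomp Require Import all_boot all_order all_algebra.
From mathcomp Require Import all_classical all_reals all_analysis.

Set Implicit Arguments.
Unset Strict Implicit.
Unset Printing Implicit Defensive.

Import Order.TTheory GRing.Theory Num.Theory.
Import numFieldNormedType.Exports.

Local Open Scope classical_set_scope.
Local Open Scope ring_scope.

(* Vectors of R^(l n) are stored as n x l matrices X whose i-th row is x_i, so
   that (L (x) I_l) x is L *m X. *)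

(* The norm that the library puts on matrices is the sup norm; Euclidean norms
   and inner products are expressed through dot. *)
Definition dot (R : realType) (m n : nat) (A B : 'M[R]_(m, n)) : R :=
  \sum_i \sum_j A i j * B i j.

Definition gradient (R : realType) (m n : nat) (f : 'M[R]_(m, n) -> R)
    (X : 'M[R]_(m, n)) : 'M[R]_(m, n) :=
  \matrix_(i, j) 'D_(delta_mx i j) f X.

Definition twice_differentiable (R : realType) (m n : nat)
    (f : 'M[R]_(m, n) -> R) : Prop :=
  (forall X, differentiable f X) /\ (forall X, differentiable (gradient f) X).

Definition strongly_convex (R : realType) (m n : nat)
    (f : 'M[R]_(m, n) -> R) : Prop :=
  exists2 c : R, 0 < c & forall (X Y : 'M[R]_(m, n)) (t : R), 0 <= t <= 1 ->
    f (t *: X + (1 - t) *: Y) <=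
      t * f X + (1 - t) * f Y - c / 2 * t * (1 - t) * dot (X - Y) (X - Y).

Definition objective (R : realType) (n l : nat) (fi : 'I_n -> 'rV[R]_l -> R)
    (X : 'M[R]_(n, l)) : R :=
  \sum_i fi i (row i X).

Definition slater (R : realType) (n l : nat) (g : nat -> R -> R)
    (mg : 'I_n -> 'I_l -> nat) : Prop :=
  exists X : 'M[R]_(n, l),
    (forall i q k, X i k = X q k) /\
    (forall i k (j : 'I_(mg i k)), g j (X i k) < 0).

Definition laplacian (R : realType) (n : nat) (a : 'M[R]_n) : 'M[R]_n :=
  diag_mx (\row_i \sum_q a i q) - a.

Definition edge_diff (R : realType) (n l : nat) (X : 'M[R]_(n, l))
    (i q : 'I_n) : 'rV[R]_l :=
  row i X - row q X.

Definition weight_rate (R : realType) (l : nat) (diq : R)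
    (p : 'rV[R]_l * 'rV[R]_l) : R :=
  diq * (dot p.1 p.1 + dot p.2 p.2).

(* [a]^+_b *)
Definition proj_pos (R : realType) (a b : R) : R :=
  if (0 < b) || (0 < a) then a else 0.

(* The multipliers theta^{ik}_j, j < m_g^{ik}, are the entries of one row
   vector whose positions enumerate the triples (i, k, j). *)
Definition mult_index (n l : nat) (mg : 'I_n -> 'I_l -> nat) : finType :=
  {ik : 'I_n * 'I_l & 'I_(mg ik.1 ik.2)}.

Definition mult (R : realType) (n l : nat) (mg : 'I_n -> 'I_l -> nat)
    (theta : 'rV[R]_#|mult_index mg|) (i : 'I_n) (k : 'I_l)
    (j : 'I_(mg i k)) : R :=
  theta 0 (enum_rank
    (existT (fun ik : 'I_n * 'I_l => 'I_(mg ik.1 ik.2)) (i, k) j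
       : mult_index mg)).

Notation state R n l mg :=
  ('M[R]_(n, l) * 'M[R]_n * 'M[R]_(n, l) * 'rV[R]_#|mult_index mg|)%type.

Definition st_x (R : realType) (n l : nat) (mg : 'I_n -> 'I_l -> nat)
  (z : state R n l mg) : 'M[R]_(n, l) := z.1.1.1.
Definition st_a (R : realType) (n l : nat) (mg : 'I_n -> 'I_l -> nat)
  (z : state R n l mg) : 'M[R]_n := z.1.1.2.
Definition st_alpha (R : realType) (n l : nat) (mg : 'I_n -> 'I_l -> nat)
  (z : state R n l mg) : 'M[R]_(n, l) := z.1.2.
Definition st_theta (R : realType) (n l : nat) (mg : 'I_n -> 'I_l -> nat)
  (z : state R n l mg) : 'rV[R]_#|mult_index mg| := z.2.

Definition graph_weights (R : realType) (n : nat) (e : rel 'I_n)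
    (a : 'M[R]_n) : Prop :=
  forall i q, [/\ a i q = a q i, e i q -> 0 < a i q & ~~ e i q -> a i q = 0].

Definition state_space (R : realType) (n l : nat) (e : rel 'I_n)
    (mg : 'I_n -> 'I_l -> nat) : set (state R n l mg) :=
  [set z | graph_weights e (st_a z) /\
           forall i k j, 0 <= mult (st_theta z) (i := i) (k := k) j].

(* An open neighbourhood of the state space on which storage functions are
   required to be of class C^1; nothing is asked for where the weight of an
   edge vanishes. *)
Definition storage_domain (R : realType) (n l : nat) (e : rel 'I_n)
    (mg : 'I_n -> 'I_l -> nat) : set (state R n l mg) :=
  [set z | forall i q, e i q -> 0 < st_a z i q].

Definition system_H1 (R : realType) (n l : nat) (e : rel 'I_n)
    (d : 'I_n -> 'I_n -> R) (f : 'M[R]_(n, l) -> R)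
    (x dx : 'M[R]_(n, l)) (da : 'M[R]_n) (ux u y : 'M[R]_(n, l)) : Prop :=
  [/\ dx = - gradient f x + ux + u,
      forall i q, e i q ->
        da i q = weight_rate (d i q) (edge_diff x i q, edge_diff dx i q)
    & y = x].

Definition system_H2 (R : realType) (n l : nat)
    (alpha dalpha u y : 'M[R]_(n, l)) : Prop :=
  dalpha = u /\ y = alpha.

Definition system_H3 (R : realType) (n l : nat) (g : nat -> R -> R)
    (mg : 'I_n -> 'I_l -> nat) (theta dtheta : 'rV[R]_#|mult_index mg|)
    (u y : 'M[R]_(n, l)) : Prop :=
  (forall i k (j : 'I_(mg i k)),
     mult dtheta j = proj_pos (g j (u i k)) (mult theta j)) /\
  y = \matrix_(i, k) \sum_(j < mg i k) mult theta j * derive1 (g j) (u i k).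

(* z is the state, dz its velocity, and (ux, y) the values at the port. *)
Definition interconnection (R : realType) (n l : nat) (e : rel 'I_n)
    (d : 'I_n -> 'I_n -> R) (f : 'M[R]_(n, l) -> R) (g : nat -> R -> R)
    (mg : 'I_n -> 'I_l -> nat) (z dz : state R n l mg)
    (ux y : 'M[R]_(n, l)) : Prop :=
  let L := laplacian (st_a z) in
  exists (u1 y1 u2 y2 u3 y3 : 'M[R]_(n, l)),
    [/\ system_H1 e d f (st_x z) (st_x dz) (st_a dz) ux u1 y1,
        system_H2 (st_alpha z) (st_alpha dz) u2 y2
      & system_H3 g (st_theta z) (st_theta dz) u3 y3] /\
    [/\ u1 = - (L *m y2) - y3, u2 = L *m y1, u3 = y1 & y = y1].

(* Solutions on [0, T[. The projection makes the vector field discontinuous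
   where a multiplier vanishes, so that theta need not be differentiable at such
   times; continuous curves whose right derivative is everywhere given by the
   dynamics are exactly the Caratheodory solutions. *)
Definition network_trajectory (R : realType) (n l : nat) (e : rel 'I_n)
    (d : 'I_n -> 'I_n -> R) (f : 'M[R]_(n, l) -> R) (g : nat -> R -> R)
    (mg : 'I_n -> 'I_l -> nat) (T : R) (z dz : R -> state R n l mg)
    (ux y : R -> 'M[R]_(n, l)) : Prop :=
  {within `[0, T[, continuous z} /\
  forall t, 0 <= t < T ->
    [/\ state_space e (z t),
        h^-1 *: (z (t + h) - z t) @[h --> 0^'+] --> dz t,
        interconnection e d f g (z t) (dz t) (ux t) (y t)
      & ux t = - (laplacian (st_a (z t)) *m st_x (z t))].

Definition C1_on (R : realType) (X : normedModType R) (D : set X)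
    (V : X -> R) : Prop :=
  forall z, D z ->
    differentiable V z /\ forall v, {for z, continuous (fun w => 'D_v V w)}.

(* phi' <= w on [0, T[ for a function phi that may fail to be differentiable:
   the upper right derivative is at most w and there is no upward jump. Storage
   functions of Krasovskii type jump downwards when a multiplier reaches 0. *)
Definition derivative_le (R : realType) (T : R) (phi w : R -> R) : Prop :=
  forall t, 0 <= t < T -> forall eps, 0 < eps ->
    (\forall h \near 0^'+, phi (t + h) - phi t <= h * (w t + eps)) /\
    (0 < t -> \forall s \near t^'-, phi t <= phi s + eps).

(* A storage function takes the state and its velocity as arguments, hence
   Krasovskii-type functions are included. *)
Definition passive (R : realType) (X : normedModType R) (m p : nat) (D : set X)
    (trajectory : R -> (R -> X) -> (R -> X) ->
                  (R -> 'M[R]_(m, p)) -> (R -> 'M[R]_(m, p)) -> Prop) : Prop :=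
  exists V : X * X -> R,
    [/\ C1_on (D `*` setT) V,
        forall z v, D z -> 0 <= V (z, v)
      & forall T z dz u y, trajectory T z dz u y ->
          derivative_le T (fun t => V (z t, dz t)) (fun t => dot (u t) (y t))].

(* Main.v *)
(* Let (X_star, theta_star) be a Karush-Kuhn-Tucker point of the problem and
   b := - (grad f X_star + sum theta_star grad g), whose columns sum to 0.
   The classical saddle-point function
     E = 1/2 |x - X_star|^2 + 1/2 |alpha - w|^2 + 1/2 |theta - theta_star|^2,
   where L w = b, satisfies E' <= - x^T L x - <alpha - w, w'>. The last term
   appears because the solution w = P b, with P := (L + 1 1^T)^-1, depends on the
   evolving weights. Since P' = - P L' P and L' is positive semidefinite, it is
   at most (|alpha - w|^2 + |b|^2) / 2 * tr (P L' P), and tr (P L' P) is minus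
   the derivative of tr P. Hence the storage function
     V = (E + |b|^2 / 2) exp (tr P)
   satisfies V' <= - exp (tr P) x^T L x <= - x^T L x.
   The constraints involve one scalar variable at a time, so the feasible set is
   a box and the multipliers are found coordinate by coordinate. *)

Require Import Defs.
From HB Require Import structures.
From mathcomp Require Import all_boot all_order all_algebra.
From mathcomp Require Import all_classical all_reals all_analysis.
From mathcomp Require Import ring lra.

Set Implicit Arguments.
Unset Strict Implicit.
Unset Printing Implicit Defensive.

Import Order.TTheory GRing.Theory Num.Theory.
Import numFieldNormedType.Exports.

Local Open Scope classical_set_scope.
Local Open Scope ring_scope.

(** * Rules of calculus for functions of class C^1 on an open set *)

Section C1_functions.
Context (R : realType) (X : normedModType R) (D : set X).
Hypothesis D_open : open D.
Implicit Types f g : X -> R.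

Lemma C1_diff f z : C1_on D f -> D z -> differentiable f z.
Proof. by move=> /(_ z) fD /fD []. Qed.

Lemma C1_derivable f z v : C1_on D f -> D z -> derivable f z v.
Proof. by move=> fD Dz; exact/diff_derivable/(C1_diff fD). Qed.

(** A formula [df] for the derivatives that is valid only on [D] suffices: as [D] is open, the
    formula also holds near each of its points, which is what continuity of the derivative
    requires. *)
Lemma C1_onP f (df : X -> X -> R) :
  (forall z, D z -> differentiable f z) ->
  (forall z v, D z -> 'D_v f z = df v z) ->
  (forall z v, D z -> {for z, continuous (df v)}) -> C1_on D f.
Proof.
move=> fD fE dfc z Dz; split=> [|v]; first exact: fD.
rewrite /prop_for /continuous_at /= (fE z v Dz); apply: cvg_trans (dfc z v Dz).
apply: near_eq_cvg; have := open_nbhs_nbhs (conj D_open Dz).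
by apply: filterS => w Dw; rewrite fE.
Qed.

Lemma C1_cst (c : R) : C1_on D (cst c).
Proof.
apply: (@C1_onP _ (fun _ _ => 0)) => [z _|z v _|z v _].
- exact: differentiable_cst.
- exact: derive_cst.
- exact: cvg_cst.
Qed.

Lemma C1_linear f : scalar f -> continuous f -> C1_on D f.
Proof.
move=> flin fc; pose F : {linear X -> R^o} :=
  HB.pack f (GRing.isLinear.Build R X R^o _ f flin).
apply: (@C1_onP _ (fun v _ => f v)) => [z _|z v _|z v _].
- exact: (@linear_differentiable _ _ _ F).
- by rewrite deriveE ?(@diff_lin _ _ _ F)//; exact: (@linear_differentiable _ _ _ F).
- exact: cvg_cst.
Qed.

Lemma C1_add f g : C1_on D f -> C1_on D g -> C1_on D (fun z => f z + g z).
Proof.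
move=> fC gC; apply: (@C1_onP _ (fun v z => 'D_v f z + 'D_v g z)) => [z Dz|z v Dz|z v Dz].
- by apply: differentiableD; exact: C1_diff.
- by apply: deriveD; exact: C1_derivable.
- by apply: cvgD; [have [_] := fC z Dz|have [_] := gC z Dz]; apply.
Qed.

Lemma C1_mul f g : C1_on D f -> C1_on D g -> C1_on D (fun z => f z * g z).
Proof.
move=> fC gC.
apply: (@C1_onP _ (fun v z => f z * 'D_v g z + g z * 'D_v f z)) => [z Dz|z v Dz|z v Dz].
- by apply: differentiableM; exact: C1_diff.
- by apply: deriveM; exact: C1_derivable.
- have [fd fc] := fC z Dz; have [gd gc] := gC z Dz.
  apply: cvgD; apply: cvgM.
  + exact: differentiable_continuous.
  + exact: gc.
  + exact: differentiable_continuous.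
  + exact: fc.
Qed.

Lemma C1_sum (I : Type) (r : seq I) (F : I -> X -> R) :
  (forall i, C1_on D (F i)) -> C1_on D (fun z => \sum_(i <- r) F i z).
Proof.
move=> FC; elim: r => [|i r IHr].
  by under eq_fun do rewrite big_nil; exact: C1_cst.
by under eq_fun do rewrite big_cons; exact: C1_add.
Qed.

Lemma C1_prod (I : Type) (r : seq I) (F : I -> X -> R) :
  (forall i, C1_on D (F i)) -> C1_on D (fun z => \prod_(i <- r) F i z).
Proof.
move=> FC; elim: r => [|i r IHr].
  by under eq_fun do rewrite big_nil; exact: C1_cst.
by under eq_fun do rewrite big_cons; exact: C1_mul.
Qed.

Lemma C1_inv f : (forall z, D z -> f z != 0) -> C1_on D f ->
  C1_on D (fun z => (f z)^-1).
Proof.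
move=> f0 fC.
apply: (@C1_onP _ (fun v z => - (f z) ^- 2 *: 'D_v f z)) => [z Dz|z v Dz|z v Dz].
- by apply: differentiableV; [exact: C1_diff|exact: f0].
- by apply: deriveV; [exact: f0|exact: C1_derivable].
- have [fd fc] := fC z Dz; have fz := differentiable_continuous fd.
  apply: cvgM; last exact: fc.
  apply: cvgN; apply: cvgV; first by rewrite sqrf_eq0 f0.
  exact: cvgM.
Qed.

Lemma C1_exp f : C1_on D f -> C1_on D (fun z => expR (f z)).
Proof.
move=> fC.
have expd (x : R) : differentiable (@expR R) x by exact/derivable1_diffP/derivable_expR.
apply: (@C1_onP _ (fun v z => 'D_v f z * expR (f z))) => [z Dz|z v Dz|z v Dz].
- by apply: differentiable_comp; [exact: C1_diff|].
- have fd := C1_diff fC Dz.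
  rewrite deriveE; last exact: differentiable_comp.
  rewrite (@diff_comp _ _ _ _ f (@expR R))//= deriveE//.
  by rewrite diff1E// derive1E derive_val.
- have [fd fc] := fC z Dz; apply: cvgM; first exact: fc.
  apply: continuous_comp; first exact: differentiable_continuous.
  exact: continuous_expR.
Qed.

Lemma C1_det (m : nat) (A : X -> 'M[R]_m) :
  (forall i j, C1_on D (fun z => A z i j)) -> C1_on D (fun z => \det (A z)).
Proof.
move=> AC; apply: C1_sum => s; apply: C1_mul; first exact: C1_cst.
by apply: C1_prod => i; exact: AC.
Qed.

(** By Cramer's rule the entries of the inverse are quotients of polynomials in the entries of [A],
    with a determinant that does not vanish on [D]. *)
Lemma C1_adjugate_inverse (m : nat) (A : X -> 'M[R]_m) (i j : 'I_m) :
  (forall z, D z -> A z \in unitmx) ->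
  (forall i j, C1_on D (fun z => A z i j)) ->
  C1_on D (fun z => ((\det (A z))^-1 *: \adj (A z)) i j).
Proof.
move=> Au AC; under eq_fun do rewrite !mxE; apply: C1_mul.
  by apply: C1_inv; [move=> z /Au; rewrite unitmxE unitfE|exact: C1_det].
apply: C1_mul; first exact: C1_cst.
by apply: C1_det => p q; under eq_fun do rewrite !mxE; exact: AC.
Qed.

End C1_functions.

(** * The Euclidean inner product of matrices *)

Section dot_theory.
Context (R : realType) (m n : nat).
Implicit Types A B : 'M[R]_(m, n).

Lemma dotDl A A' B : dot (A + A') B = dot A B + dot A' B.
Proof.
rewrite /dot -big_split/=; apply: eq_bigr => i _.
by rewrite -big_split/=; apply: eq_bigr => j _; rewrite mxE mulrDl.
Qed.

Lemma dotC A B : dot A B = dot B A.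
Proof. by apply: eq_bigr => i _; apply: eq_bigr => j _; rewrite mulrC. Qed.

Lemma dotDr A B B' : dot A (B + B') = dot A B + dot A B'.
Proof. by rewrite dotC dotDl !(dotC A). Qed.

Lemma dotNl A B : dot (- A) B = - dot A B.
Proof.
rewrite /dot -sumrN; apply: eq_bigr => i _.
by rewrite -sumrN; apply: eq_bigr => j _; rewrite mxE mulNr.
Qed.

Lemma dotNr A B : dot A (- B) = - dot A B.
Proof. by rewrite dotC dotNl dotC. Qed.

Lemma dot_ge0 A : 0 <= dot A A.
Proof. by apply: sumr_ge0 => i _; apply: sumr_ge0 => j _; rewrite -expr2 sqr_ge0. Qed.

Lemma dot_eq0 A : dot A A = 0 -> A = 0.
Proof.
move=> A0; apply/matrixP => i j; rewrite mxE; apply/eqP; rewrite -sqrf_eq0.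
have i0 k : 0 <= \sum_j A k j * A k j.
  by apply: sumr_ge0 => ? _; rewrite -expr2 sqr_ge0.
have j0 k : 0 <= A i k * A i k by rewrite -expr2 sqr_ge0.
have /= Ai := psumr_eq0P (fun k _ => i0 k) A0 (i := i) isT.
by have /= := psumr_eq0P (fun k _ => j0 k) Ai (i := j) isT; rewrite expr2 => ->.
Qed.

Lemma dot_AMGM A B : dot A B <= (dot A A + dot B B) / 2.
Proof.
have := dot_ge0 (A - B).
rewrite dotDl !dotDr !dotNl !dotNr opprK (dotC B A) => h.
rewrite ler_pdivlMr//; lra.
Qed.

(** The norm is the largest absolute value of an entry, and the square of each entry is one of the
    nonnegative terms of [dot A A]. *)
Lemma norm_sqr_le_dot A : `|A| ^+ 2 <= dot A A.
Proof.
rewrite -[leRHS]sqr_sqrtr ?dot_ge0// lerXn2r ?nnegrE ?sqrtr_ge0//.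
rewrite [leLHS]/Num.norm /= mx_normrE; apply: bigmax_le; first exact: sqrtr_ge0.
move=> [i j] _ /=; rewrite -sqrtr_sqr ler_wsqrtr// /dot.
rewrite (bigD1 i)//= (bigD1 j)//= -expr2 -addrA lerDl addr_ge0//.
  by apply: sumr_ge0 => ? _; rewrite -expr2 sqr_ge0.
by apply: sumr_ge0 => ? _; apply: sumr_ge0 => ? _; rewrite -expr2 sqr_ge0.
Qed.

End dot_theory.

(** * Tangent inequalities for convex functions *)

Section convexity.
Context (R : realType).

Lemma derive_at_right (V : normedModType R) (f : V -> R) (x v : V) :
  derivable f x v ->
  h^-1 * (f (h *: v + x) - f x) @[h --> 0^'+] --> 'D_v f x.
Proof. by move=> fd; apply: cvg_dnbhs_at_right; exact: fd. Qed.

(** The difference quotient at [x] towards [y] with step [h] is at most [f y - f x - c * (1 - h)];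
    let [h] tend to 0. Convexity is the case [c = 0]; strong convexity gives a [c] proportional to
    the squared distance of [x] and [y]. *)
Lemma convex_tangent (V : normedModType R) (f : V -> R) (x y : V) (c : R) :
  derivable f x (y - x) ->
  (forall t, 0 <= t <= 1 ->
    f (t *: y + (1 - t) *: x) <= t * f y + (1 - t) * f x - c * t * (1 - t)) ->
  'D_(y - x) f x + c <= f y - f x.
Proof.
move=> fd fc; rewrite -lerBrDr.
have idR : (fun h : R => h) @ 0^'+ --> (0 : R) by apply: cvg_at_right_filter; exact: cvg_id.
have : f y - f x - c * (1 - h) @[h --> 0^'+] --> f y - f x - c * (1 - 0).
  apply: cvgB; first exact: cvg_cst.
  by apply: cvgMl_tmp; apply: cvgB => //; exact: cvg_cst.
rewrite subr0 mulr1 => rhs; apply: (ler_cvg_to (derive_at_right fd) rhs).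
near=> h.
have h0 : 0 < h by near: h; exact: nbhs_right_gt.
have h1 : h <= 1 by near: h; exact: nbhs_right_le.
rewrite ler_pdivrMl// lerBlDr.
have -> : h *: (y - x) + x = h *: y + (1 - h) *: x.
  by rewrite scalerBr scalerBl scale1r addrAC addrA.
apply: le_trans (fc h _) _; first by rewrite (ltW h0) h1.
by rewrite le_eqVlt; apply/orP; left; apply/eqP; ring.
Unshelve. all: by end_near. Qed.

Lemma convex_functionE (g : R -> R) :
  convex_function [set: convex_lmodType R^o] g -> forall x y t, 0 <= t <= 1 ->
  g (t * y + (1 - t) * x) <= t * g y + (1 - t) * g x.
Proof.
move=> gc x y t /andP[t0 t1].
exact: (gc (Itv01 t0 t1) y x (in_setT _) (in_setT _)).
Qed.

Lemma convex_function_tangent (g : R -> R) (x y : R) :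
  convex_function [set: convex_lmodType R^o] g ->
  (forall s, derivable g s 1) -> derive1 g x * (y - x) <= g y - g x.
Proof.
move=> gc gd; have gdiff : differentiable g x by apply/derivable1_diffP; exact: gd.
have := @convex_tangent R^o g x y 0 (diff_derivable gdiff).
rewrite addr0 deriveE// diff1E//= -[_ *: _]/(_ * _) mulrC; apply => t t01.
by rewrite !mul0r subr0; exact: convex_functionE.
Qed.

End convexity.

(** * Multipliers for inequality constraints on one scalar variable *)

Section Karush_Kuhn_Tucker.
Context (R : realType).

(** On the line a single active constraint is enough to balance [c]. If none has a slope of the sign
    opposite to [c], a small move against [c] stays feasible and contradicts the minimality of
    [s]. *)
Lemma interval_multiplier (I : finType) (G : I -> R -> R) (s s0 c : R) :
  (forall i x y, derive1 (G i) x * (y - x) <= G i y - G i x) ->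
  (forall i x, derivable (G i) x 1) ->
  (forall i, G i s <= 0) -> (forall i, G i s0 < 0) ->
  (forall y, (forall i, G i y <= 0) -> 0 <= c * (y - s)) ->
  exists th : I -> R, [/\ forall i, 0 <= th i, forall i, th i * G i s = 0 &
    c + \sum_i th i * derive1 (G i) s = 0].
Proof.
move=> Gtan Gd Gs Gs0 cmin.
have [->|c0] := eqVneq c 0.
  exists (fun=> 0); split=> [//|i|]; first by rewrite mul0r.
  by rewrite big1 ?addr0// => i _; rewrite mul0r.
have [[i [Gi0 Gic]]|noi] := pselect (exists i, G i s = 0 /\ derive1 (G i) s * c < 0).
  have Gi' : derive1 (G i) s != 0 by apply/negP => /eqP G0; rewrite G0 mul0r ltxx in Gic.
  exists (fun j => if j == i then - c / derive1 (G i) s else 0); split=> [j|j|].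
  - case: eqP => // _; rewrite -[X in X / _]mul1r.
    rewrite -(pmulr_lge0 _ (_ : 0 < (derive1 (G i) s) ^+ 2)); last by rewrite exprn_even_gt0.
    rewrite mul1r expr2 mulrA divfK// mulNr oppr_ge0 mulrC; exact: ltW.
  - by case: eqP => [->|_]; rewrite ?Gi0 ?mulr0 ?mul0r.
  - rewrite (bigD1 i)//= eqxx divfK// big1 ?addr0 ?subrr// => j /negbTE ->.
    by rewrite mul0r.
(* No active constraint opposes [c]. It is shown that [s - h * c] is feasible for small positive
   [h], although [c * (- h * c)] is negative. *)
exfalso.
have Gdiff i x : differentiable (G i) x by apply/derivable1_diffP; exact: Gd.
have line : s - h * c @[h --> 0^'+] --> s.
  rewrite -[X in _ --> X]subr0 -[X in _ - X](mul0r c).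
  apply: cvgB; first exact: cvg_cst.
  by apply: cvgMr_tmp; apply: cvg_at_right_filter; exact: cvg_id.
have : \forall h \near 0^'+, forall i, G i (s - h * c) <= 0.
  apply: filter_forall => i.
  have [Gi0|Gi0] := eqVneq (G i s) 0; last first.
    have Gilt : G i s < 0 by rewrite lt_neqAle Gi0 Gs.
    have : G i (s - h * c) @[h --> 0^'+] --> G i s.
      by apply: continuous_cvg => //; exact: differentiable_continuous.
    move=> /cvgr_lt/(_ _ Gilt); apply: filterS => h; exact: ltW.
  have Gic : 0 < derive1 (G i) s * c.
    rewrite lt_neqAle eq_sym mulf_neq0//= ?leNgt.
      by apply/negP => Gic; apply: noi; exists i.
    (* With slope 0 at [s], the tangent inequality would make [G i s = 0] the minimum of [G i],
       against the strictly feasible point [s0]. *)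
    apply/negP => /eqP G'0; have := Gtan i s s0.
    by rewrite G'0 mul0r Gi0 subr0 leNgt Gs0.
  have := @derive_at_right R R^o (G i) s (- c) (diff_derivable (Gdiff i s)).
  rewrite deriveE// diff1E//= -[_ *: _]/(- c * _) => /cvgr_lt/(_ 0).
  rewrite mulNr oppr_lt0 mulrC => /(_ Gic) near_lt.
  near=> h.
  have h0 : 0 < h by near: h; exact: nbhs_right_gt.
  have : h^-1 * (G i (h *: - c + s) - G i s) < 0 by near: h; exact: near_lt.
  rewrite pmulr_rlt0 ?invr_gt0// Gi0 subr0 -[_ *: _]/(h * - c) mulrN addrC.
  exact: ltW.
move=> Gnear.
have : \forall h \near 0^'+, 0 < h /\ forall i, G i (s - h * c) <= 0.
  by apply: filterI => //; exact: nbhs_right_gt.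
case/filter_ex => h [h0 /cmin].
rewrite addrAC subrr add0r mulrN oppr_ge0 mulrCA leNgt.
by rewrite mulr_gt0// -expr2 exprn_even_gt0.
Unshelve. all: by end_near. Qed.

End Karush_Kuhn_Tucker.

(** * Existence of a constrained minimizer and of a Karush-Kuhn-Tucker point *)

Section constrained_minimizer.
Context (R : realType) (n l : nat).
Hypothesis n_gt0 : (0 < n)%N.
Variables (fi : 'I_n -> 'rV[R]_l -> R) (g : nat -> R -> R).
Variable mg : 'I_n -> 'I_l -> nat.
Hypothesis fi_diff : forall i s, differentiable (fi i) s.
Hypothesis fi_sconvex : forall i, strongly_convex (fi i).
Hypothesis g_convex : forall i k (j : 'I_(mg i k)),
  convex_function [set: convex_lmodType R^o] (g j).
Hypothesis g_diff : forall i k (j : 'I_(mg i k)) (s : R), derivable (g j) s 1.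

Let feasible (s : 'rV[R]_l) := forall i k (j : 'I_(mg i k)), g j (s 0 k) <= 0.

(** With [v := s - s0], strong convexity places each [fi i] above its tangent at [s0] by a multiple
    of [dot v v]. On the sublevel set the quadratic part is therefore at most the opposite of the
    linear part, so that [C * |v|^2 <= KK * |v|], whence the bound [KK / C]. *)
Lemma sum_sconvex_coercive (s0 : 'rV[R]_l) : exists2 B : R, 0 <= B &
  forall s, \sum_i fi i s <= \sum_i fi i s0 -> `|s - s0| <= B.
Proof.
have /choice[c cP] (i : 'I_n) : exists c : R, 0 < c /\
    forall v, 'd (fi i) s0 v + c * dot v v <= fi i (v + s0) - fi i s0.
  have [c c0 fc] := fi_sconvex i; exists (c / 2).
  split=> [|v]; first by rewrite divr_gt0.
  have := @convex_tangent R _ (fi i) s0 (v + s0) (c / 2 * dot v v).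
  rewrite addrK deriveE//; apply; first exact: diff_derivable.
  move=> t /fc /le_trans; apply; rewrite addrK le_eqVlt; apply/orP; left.
  by apply/eqP; ring.
have /choice[K KP] : forall i, exists k, 0 <= k /\
    forall v, `|'d (fi i) s0 v| <= k * `|v|.
  move=> i; have [|k k0 kP] := @linear_lipschitz R _ _ ('d (fi i) s0).
    exact: diff_continuous.
  by exists k; split=> //; exact: ltW.
pose C := \sum_i c i; pose KK := \sum_i K i.
have C0 : 0 < C.
  rewrite /C (bigD1 (Ordinal n_gt0))//= ltr_pwDl ?(cP _).1//.
  by apply: sumr_ge0 => i _; exact/ltW/(cP i).1.
have KK0 : 0 <= KK by apply: sumr_ge0 => i _; exact: (KP i).1.
exists (KK / C); first by rewrite divr_ge0// ltW.
move=> s sle; rewrite ler_pdivlMr//.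
set v := s - s0.
have [->|v0] := eqVneq v 0; first by rewrite normr0 mul0r.
have vlt : 0 < `|v| by rewrite normr_gt0.
rewrite -(ler_pM2r vlt) mulrAC -expr2.
have : \sum_i ('d (fi i) s0 v + c i * dot v v) <= 0.
  apply: (@le_trans _ _ (\sum_i (fi i (v + s0) - fi i s0))).
    by apply: ler_sum => i _; exact: (cP i).2.
  by rewrite /v subrK sumrB subr_le0.
rewrite big_split/= -mulr_suml -/C => sum_le.
have : C * `|v| ^+ 2 <= C * dot v v by rewrite ler_pM2l// norm_sqr_le_dot.
move=> le1.
have le2 : - (\sum_i 'd (fi i) s0 v) <= KK * `|v|.
  rewrite -sumrN /KK mulr_suml; apply: ler_sum => i _.
  by rewrite (le_trans _ ((KP i).2 v))// -normrN ler_norm.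
rewrite mulrC (le_trans le1)// (le_trans _ le2)//; lra.
Qed.

(** The feasible points at which the sum does not exceed its value at [s0] form a closed bounded
    set, hence a compact one, on which the minimum is attained. *)
Lemma exists_constrained_minimizer (s0 : 'rV[R]_l) : feasible s0 ->
  exists2 s, feasible s & forall s', feasible s' -> \sum_i fi i s <= \sum_i fi i s'.
Proof.
move=> s0F; pose F (s : 'rV[R]_l) := \sum_i fi i s.
have Fc : continuous F.
  move=> s; apply: differentiable_continuous.
  by rewrite /F -fct_sumE; exact: differentiable_sum.
pose A := [set s | feasible s /\ F s <= F s0].
have A0 : A !=set0 by exists s0; split.
have Acl : closed A.
  have -> : A = (\bigcap_(i in [set: 'I_n]) \bigcap_(k in [set: 'I_l])
      \bigcap_(j in [set: 'I_(mg i k)]) ((fun s : 'rV[R]_l => g j (s 0 k)) @^-1` [set y | y <= 0]))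
      `&` (F @^-1` [set y | y <= F s0]).
    apply/seteqP; split=> s [sF sle]; split=> //.
      by move=> i _ k _ j _; exact: sF.
    by move=> i k j; exact: (sF i I k I j I).
  apply: closedI.
    apply: closed_bigI => i _; apply: closed_bigI => k _; apply: closed_bigI => j _.
    apply: preimage_closed; last exact: closed_le.
    move=> s _; apply: (@continuous_comp _ _ _ (fun s : 'rV[R]_l => s 0 k) (g j)).
      exact: coord_continuous.
    by apply/differentiable_continuous/derivable1_diffP/g_diff.
  by apply: preimage_closed; [move=> s _; exact: Fc|exact: closed_le].
have Ab : bounded_set A.
  have [B B0 BP] := sum_sconvex_coercive s0.
  exists (B + `|s0|); split; first exact: num_real.
  move=> M BM s [_ /BP sB] /=; rewrite (le_trans _ (ltW BM))//.
  by rewrite -[s](subrK s0) (le_trans (ler_normD _ _))// lerD2r.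
have [|s] := EVT_min_rV A0 (bounded_closed_compact Ab Acl) (f := F).
  exact: continuous_subspaceT.
rewrite inE => -[sF sle] smin; exists s => // s' s'F.
have [s'le|/ltW s'ge] := leP (F s') (F s0); first by apply: smin; rewrite inE.
exact: le_trans s'ge.
Qed.

(** Consensus is built in by minimizing over one common vector [s]. Stationarity then holds only
    after summation over the agents; the remaining imbalance between agents is what alpha has to
    compensate. *)
Lemma exists_KKT_point (s0 : 'rV[R]_l) :
  (forall i k (j : 'I_(mg i k)), g j (s0 0 k) < 0) ->
  exists (s : 'rV[R]_l) (th : forall i k, 'I_(mg i k) -> R),
  [/\ feasible s, forall i k j, 0 <= th i k j,
     forall i k j, th i k j * g j (s 0 k) = 0 &
     forall k, \sum_i ('D_(delta_mx 0 k) (fi i) s +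
       \sum_j th i k j * derive1 (g j) (s 0 k)) = 0].
Proof.
move=> s0lt; have [|s sF smin] := @exists_constrained_minimizer s0.
  by move=> i k j; exact/ltW/s0lt.
exists s.
pose c (k : 'I_l) := \sum_i 'D_(delta_mx 0 k) (fi i) s.
(* Under consensus the constraints of all agents on their [k]-th entries bear on the single scalar
   [s 0 k], hence the index type of pairs of an agent and one of its constraints. *)
have /fin_all_exists[th thP] (k : 'I_l) : exists th : {i & 'I_(mg i k)} -> R,
  [/\ forall p, 0 <= th p, forall p, th p * g (tagged p) (s 0 k) = 0 &
    c k + \sum_p th p * derive1 (g (tagged p)) (s 0 k) = 0].
  apply: (@interval_multiplier R {i & 'I_(mg i k)} (fun p => g (tagged p)) (s 0 k) (s0 0 k)).
  - by move=> [i j] x y; apply: convex_function_tangent; [exact: g_convex|exact: g_diff].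
  - by move=> [i j] x; exact: g_diff.
  - by move=> [i j]; exact: sF.
  - by move=> [i j]; exact: s0lt.
  (* Only the [k]-th entry moves, towards [y]: the constraints on the other entries are unaffected,
     and those on this entry hold along the segment by convexity. So the derivative of the sum along
     [v] is nonnegative at the minimizer. *)
  move=> y yF; pose v : 'rV[R]_l := (y - s 0 k) *: delta_mx 0 k.
  have segF h : 0 <= h <= 1 -> feasible (h *: v + s).
    move=> h01 i k' j; rewrite !mxE eqxx/=.
    have [kk|_] := eqVneq k' k; last by rewrite !mulr0 add0r; exact: sF.
    move: j; rewrite kk => j.
    rewrite mulr1 (_ : _ + _ = h * y + (1 - h) * s 0 k); last by ring.
    have /andP[h0 h1] := h01.
    apply: (le_trans (convex_functionE (g_convex j) _ _ h01)).
    rewrite -[leRHS]addr0 lerD// mulr_ge0_le0 ?subr_ge0//.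
    exact: (yF (Tagged _ j)).
  pose F (s : 'rV[R]_l) := \sum_i fi i s.
  have FE : F = \sum_i fi i by rewrite fct_sumE.
  have Fd : differentiable F s by rewrite FE; exact: differentiable_sum.
  have cE : c k = 'D_(delta_mx 0 k) F s.
    by rewrite FE derive_sum// => i; exact: diff_derivable.
  have -> : c k * (y - s 0 k) = 'D_v F s.
    by rewrite cE mulrC !deriveE// linearZ.
  apply: (ler_cvg_to (cvg_cst 0) (derive_at_right (diff_derivable Fd))).
  near=> h.
  have h0 : 0 < h by near: h; exact: nbhs_right_gt.
  have h1 : h <= 1 by near: h; exact: nbhs_right_le.
  rewrite mulr_ge0 ?invr_ge0 ?(ltW h0)// subr_ge0.
  by apply: smin; apply: segF; rewrite (ltW h0) h1.
exists (fun i k j => th k (Tagged _ j)); split=> [//|i k j|i k j|k].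
- by have [+ _ _] := thP k; apply.
- by have [_ /(_ (Tagged _ j)) + _] := thP k.
- have [_ _ thk] := thP k; rewrite -[RHS]thk big_split/= -/(c k); congr (_ + _).
  by rewrite sig_big_dep; apply: eq_bigr => -[].
Unshelve. all: by end_near. Qed.

End constrained_minimizer.

(** * Inner product, matrix products and the Cauchy-Schwarz inequality *)

Section dot_matrix_theory.
Context (R : realType).

Lemma dotZl (m n : nat) (c : R) (A B : 'M[R]_(m, n)) : dot (c *: A) B = c * dot A B.
Proof.
rewrite /dot mulr_sumr; apply: eq_bigr => i _; rewrite mulr_sumr.
by apply: eq_bigr => j _; rewrite mxE mulrA.
Qed.

Lemma dot0l (m n : nat) (A : 'M[R]_(m, n)) : dot 0 A = 0.
Proof. by rewrite -(scale0r (0 : 'M[R]_(m, n))) dotZl mul0r. Qed.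

Lemma dot_trace (m n : nat) (A B : 'M[R]_(m, n)) : dot A B = \tr (A^T *m B).
Proof.
rewrite /dot exchange_big /mxtrace; apply: eq_bigr => j _ /=.
by rewrite mxE; apply: eq_bigr => i _; rewrite mxE.
Qed.

Lemma dot_mull (m n p : nat) (C : 'M[R]_(m, n)) (A : 'M[R]_(n, p)) (B : 'M[R]_(m, p)) :
  dot (C *m A) B = dot A (C^T *m B).
Proof. by rewrite !dot_trace trmx_mul mulmxA. Qed.

(** The squared norm of [dot A A *: B - dot A B *: A] equals [dot A A] times the difference of the
    two sides. *)
Lemma dot_Cauchy_Schwarz (m n : nat) (A B : 'M[R]_(m, n)) :
  dot A B ^+ 2 <= dot A A * dot B B.
Proof.
have [A0|A0] := eqVneq (dot A A) 0.
  by rewrite A0 mul0r (dot_eq0 A0) dot0l expr0n.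
have Apos : 0 < dot A A by rewrite lt_neqAle eq_sym A0 dot_ge0.
have := dot_ge0 (dot A A *: B - dot A B *: A).
rewrite dotDl !dotDr !dotNl !dotNr !dotZl !(dotC _ (_ *: _)) !dotZl (dotC B A) => h.
rewrite -subr_ge0 -(pmulr_rge0 _ Apos); apply: le_trans h _.
by rewrite le_eqVlt; apply/orP; left; apply/eqP; ring.
Qed.

Lemma dot_mul_le (m n : nat) (r : 'rV[R]_m) (A : 'M[R]_(m, n)) :
  dot (r *m A) (r *m A) <= dot r r * dot A A.
Proof.
rewrite {1}/dot big_ord1.
have -> : dot A A = \sum_k dot (col k A) (col k A).
  rewrite /dot exchange_big; apply: eq_bigr => k _ /=; apply: eq_bigr => i _.
  by rewrite big_ord1 !mxE.
have rE : dot r r = dot r^T r^T.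
  by rewrite /dot big_ord1; apply: eq_bigr => i _; rewrite big_ord1 !mxE.
rewrite mulr_sumr; apply: ler_sum => k _; rewrite rE -expr2.
apply: le_trans (dot_Cauchy_Schwarz _ _); rewrite le_eqVlt; apply/orP; left.
apply/eqP; congr (_ ^+ 2); rewrite !mxE; apply: eq_bigr => i _.
by rewrite big_ord1 !mxE.
Qed.

End dot_matrix_theory.

(** * Weighted Laplacians and their rank-one perturbation *)

Section Laplacian.
Context (R : realType) (n : nat).
Implicit Types s a : 'M[R]_n.

Lemma laplacian_mulE s (m : nat) (B : 'M[R]_(n, m)) i k :
  (laplacian s *m B) i k = \sum_q s i q * (B i k - B q k).
Proof.
rewrite /laplacian mulmxBl mul_diag_mx !mxE mulr_suml -sumrB.
by apply: eq_bigr => q _; rewrite mulrBr.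
Qed.

Lemma laplacian_tr s : s^T = s -> (laplacian s)^T = laplacian s.
Proof. by move=> sT; rewrite /laplacian linearB/= tr_diag_mx sT. Qed.

Lemma laplacian_consensus s (m : nat) (B : 'M[R]_(n, m)) :
  (forall i q k, B i k = B q k) -> laplacian s *m B = 0.
Proof.
move=> Bc; apply/matrixP => i k; rewrite laplacian_mulE mxE big1// => q _.
by rewrite (Bc i q) subrr mulr0.
Qed.

(** Exchanging [i] and [q] gives, by symmetry of [s], a second expression [E2] of the same sum; the
    average of [E1] and [E2] is the sum over edge differences. *)
Lemma dot_laplacian s (m : nat) (A B : 'M[R]_(n, m)) : s^T = s ->
  dot A (laplacian s *m B) =
    2^-1 * \sum_i \sum_q s i q * dot (row i A - row q A) (row i B - row q B).
Proof.
move=> sT; have sE i q : s q i = s i q by rewrite -[in LHS]sT mxE.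
have E1 : dot A (laplacian s *m B) =
    \sum_i \sum_q s i q * dot (row i A) (row i B - row q B).
  rewrite {1}/dot; apply: eq_bigr => i _.
  under eq_bigr do rewrite laplacian_mulE mulr_sumr.
  rewrite exchange_big/=; apply: eq_bigr => q _.
  by rewrite /dot big_ord1 mulr_sumr; apply: eq_bigr => k _; rewrite !mxE mulrCA.
have E2 : dot A (laplacian s *m B) =
    \sum_i \sum_q s i q * dot (row q A) (row q B - row i B).
  rewrite E1 exchange_big/=; apply: eq_bigr => i _; apply: eq_bigr => q _.
  by rewrite sE.
suff -> : \sum_i \sum_q s i q * dot (row i A - row q A) (row i B - row q B) =
    dot A (laplacian s *m B) + dot A (laplacian s *m B).
  by field.
rewrite {1}E1 E2 -big_split/=; apply: eq_bigr => i _.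
rewrite -big_split/=; apply: eq_bigr => q _.
by rewrite -mulrDr; congr (_ * _); rewrite !(dotDl, dotDr, dotNl, dotNr); ring.
Qed.

Lemma dot_laplacian_ge0 s (m : nat) (A : 'M[R]_(n, m)) : s^T = s ->
  (forall i q, 0 <= s i q) -> 0 <= dot A (laplacian s *m A).
Proof.
move=> sT s0; rewrite dot_laplacian// mulr_ge0// sumr_ge0// => i _.
by rewrite sumr_ge0// => q _; rewrite mulr_ge0// dot_ge0.
Qed.

(* The derivative of [\tr (invmx A)] along a symmetric direction [L] is
   [- \tr (P *m L *m P)] with [P = invmx A]: this is what the weight
   [expR (\tr P)] has to absorb. *)
Lemma dot_inverse_laplacian_le s (P : 'M[R]_n) (m : nat) (A B : 'M[R]_(n, m)) :
  s^T = s -> (forall i q, 0 <= s i q) -> P^T = P ->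
  dot A (P *m laplacian s *m P *m B) <=
    (dot A A + dot B B) / 2 * \tr (P *m laplacian s *m P).
Proof.
move=> sT s0 PT.
have -> : \tr (P *m laplacian s *m P) = dot P (laplacian s *m P).
  by rewrite dot_trace PT mulmxA.
have -> : dot A (P *m laplacian s *m P *m B) = dot (P *m A) (laplacian s *m (P *m B)).
  by rewrite dot_mull PT !mulmxA.
(* Both sides are now sums over pairs [(i, q)] with the nonnegative weights [s i q]. They are
   compared term by term: the edge difference of [P *m A] is the row [row i P - row q P] times [A],
   and likewise for [B]. *)
rewrite !dot_laplacian// mulrCA ler_pM2l// mulr_sumr.
apply: ler_sum => i _; rewrite mulr_sumr; apply: ler_sum => q _.
rewrite mulrCA ler_wpM2l//; apply: le_trans (dot_AMGM _ _) _.
rewrite mulrAC ler_pM2r ?invr_gt0// mulrDl.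
by rewrite !row_mul -!mulmxBl lerD// [leRHS]mulrC dot_mul_le.
Qed.

(** The all-ones matrix removes the consensus vectors from the kernel and leaves the action on
    vectors of zero sum unchanged. *)
Definition grounded_laplacian s : 'M[R]_n := laplacian s + const_mx 1.

Let u : 'cV[R]_n := const_mx 1.

Lemma ones_mxE : const_mx 1 = u *m u^T :> 'M[R]_n.
Proof. by apply/matrixP => i j; rewrite !mxE big_ord1 !mxE mulr1. Qed.

Lemma grounded_laplacian_tr s : s^T = s ->
  (grounded_laplacian s)^T = grounded_laplacian s.
Proof. by move=> sT; rewrite linearD/= laplacian_tr// trmx_const. Qed.

Lemma dot_grounded s (m : nat) (A : 'M[R]_(n, m)) :
  dot A (grounded_laplacian s *m A) =
    dot A (laplacian s *m A) + dot (u^T *m A) (u^T *m A).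
Proof.
by rewrite mulmxDl dotDr ones_mxE dot_mull trmxK !mulmxA.
Qed.

(** For a kernel vector both nonnegative parts of the quadratic form vanish. The Laplacian part
    makes it constant along edges, hence constant by connectedness; the other part says that its
    entries sum to 0. *)
Lemma grounded_laplacian_unit (e : rel 'I_n) s : (forall i q, connect e i q) ->
  s^T = s -> (forall i q, 0 <= s i q) -> (forall i q, e i q -> 0 < s i q) ->
  grounded_laplacian s \in unitmx.
Proof.
move=> e_conn sT s0 se; rewrite unitmxE unitfE; apply/negP => /eqP/eqP/det0P[v v0 vM].
have := dot_grounded s v^T.
have -> : grounded_laplacian s *m v^T = 0.
  by rewrite -(grounded_laplacian_tr sT) -trmx_mul vM trmx0.
rewrite dotC dot0l => /esym/eqP.
rewrite paddr_eq0 ?dot_ge0 ?dot_laplacian_ge0// => /andP[/eqP q0 /eqP/dot_eq0 uv0].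
have edge_eq i q : e i q -> v 0 i = v 0 q.
  move=> eiq; move: q0; rewrite dot_laplacian// => /eqP; rewrite mulf_eq0 invr_eq0.
  rewrite pnatr_eq0/= => /eqP q0.
  have ge0 i' q' : 0 <= s i' q' *
      dot (row i' v^T - row q' v^T) (row i' v^T - row q' v^T).
    by rewrite mulr_ge0// dot_ge0.
  have := psumr_eq0P (fun i' _ => sumr_ge0 _ (fun q' _ => ge0 i' q')) q0 (i := i) isT.
  move=> /(psumr_eq0P (fun q' _ => ge0 i q')) => /(_ q isT)/eqP.
  rewrite mulf_eq0 gt_eqF ?se//= => /eqP/dot_eq0/matrixP/(_ 0 0).
  by rewrite !mxE => /eqP; rewrite subr_eq0 => /eqP.
have conn_eq i q : v 0 i = v 0 q.
  have /connectP[p + ->] := e_conn i q.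
  elim: p i => [//|x p IHp] i /= /andP[/edge_eq -> xp]; exact: IHp.
case/negP: v0; apply/eqP/rowP => i; rewrite mxE.
move/matrixP: uv0 => /(_ 0 0); rewrite !mxE.
under eq_bigr do rewrite !mxE mul1r (conn_eq _ i).
rewrite sumr_const card_ord => /eqP; rewrite mulrn_eq0 => /orP[n0|/eqP//].
by have := leq_ltn_trans (leq0n i) (ltn_ord i); rewrite lt0n n0.
Qed.

(** The trace of the symmetric inverse [P] is the quadratic form of the grounded Laplacian evaluated
    at [P] itself. *)
Lemma grounded_inverse_tr_ge0 s (P : 'M[R]_n) : s^T = s ->
  (forall i q, 0 <= s i q) -> grounded_laplacian s *m P = 1%:M -> P^T = P ->
  0 <= \tr P.
Proof.
move=> sT s0 MP PT; have := dot_grounded s P.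
rewrite MP dot_trace PT mulmx1 => ->.
by rewrite addr_ge0 ?dot_ge0 ?dot_laplacian_ge0.
Qed.

(** Multiplying the equation on the left by the row of ones kills both the Laplacian term and [b],
    which leaves [n] times the column sums of [w]. These are thus 0 and the all-ones term
    disappears. *)
Lemma laplacian_solve s (m : nat) (w b : 'M[R]_(n, m)) : s^T = s -> (0 < n)%N ->
  grounded_laplacian s *m w = b -> (forall k, \sum_i b i k = 0) ->
  laplacian s *m w = b.
Proof.
move=> sT n_gt0 Mw b0.
have uL : u^T *m laplacian s = 0.
  rewrite -(laplacian_tr sT) -trmx_mul laplacian_consensus ?trmx0// => i q k.
  by rewrite !mxE.
have ub : u^T *m b = 0.
  apply/matrixP => i k; rewrite !mxE -[RHS](b0 k); apply: eq_bigr => q _.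
  by rewrite !mxE mul1r.
have uu : u^T *m u = n%:R%:M.
  apply/matrixP => i j; rewrite !ord1 !mxE eqxx mulr1n.
  under eq_bigr do rewrite !mxE mulr1.
  by rewrite sumr_const card_ord.
have uw : u^T *m w = 0.
  move: ub; rewrite -Mw mulmxA mulmxDr uL add0r ones_mxE mulmxA uu mul_scalar_mx.
  rewrite -scalemxAl => /eqP; rewrite scaler_eq0 pnatr_eq0.
  by rewrite -leqn0 leqNgt n_gt0 => /eqP.
by rewrite -Mw [RHS]mulmxDl ones_mxE -mulmxA uw mulmx0 addr0.
Qed.

End Laplacian.

(** * Calculus of right derivatives *)

Section right_derivative.
Context (R : realType).
Implicit Types (phi psi : R -> R) (t c : R).

Record right_derivative phi t c : Prop := RightDerivative {
  right_derivative_cvg : h^-1 * (phi (t + h) - phi t) @[h --> 0^'+] --> c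
}.

Let idR : (fun h : R => h) @ 0^'+ --> (0 : R).
Proof. by apply: cvg_at_right_filter; exact: cvg_id. Qed.

Lemma right_derivative_eq phi t c c' : c = c' ->
  right_derivative phi t c -> right_derivative phi t c'.
Proof. by move->. Qed.

Lemma right_continuous_curve (X : normedModType R) (z : R -> X) t (dz : X) :
  h^-1 *: (z (t + h) - z t) @[h --> 0^'+] --> dz ->
  z (t + h) @[h --> 0^'+] --> z t.
Proof.
move=> zd; have : z t + h *: (h^-1 *: (z (t + h) - z t)) @[h --> 0^'+] --> z t + 0 *: dz.
  by apply: cvgD; [exact: cvg_cst|exact: cvgZ].
rewrite scale0r addr0; apply: cvg_trans; apply: near_eq_cvg.
near=> h; rewrite scalerA divff ?scale1r; first by rewrite addrC subrK.
by rewrite gt_eqF//; near: h; exact: nbhs_right_gt.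
Unshelve. all: by end_near. Qed.

Lemma right_derivative_continuous phi t c : right_derivative phi t c ->
  phi (t + h) @[h --> 0^'+] --> phi t.
Proof. by move=> [pc]; exact: (@right_continuous_curve R^o) pc. Qed.

(** A linear map commutes with difference quotients. The instances of interest are the coordinates
    of the state. *)
Lemma right_derivative_linear (X : normedModType R) (F : X -> R) (z : R -> X) t
    (dz : X) : scalar F -> continuous F ->
  h^-1 *: (z (t + h) - z t) @[h --> 0^'+] --> dz ->
  right_derivative (fun s => F (z s)) t (F dz).
Proof.
move=> Flin Fc zd.
have FE h : h^-1 * (F (z (t + h)) - F (z t)) = F (h^-1 *: (z (t + h) - z t)).
  have F0 : F 0 = 0 by have := Flin (-1) 0 0; rewrite scaler0 addr0 mulN1r addNr.
  have FB a b : F (a - b) = F a - F b.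
    by rewrite addrC -scaleN1r Flin mulN1r addrC.
  by rewrite -FB -[X in _ = F X]addr0 Flin F0 addr0.
split; under eq_fun do rewrite FE.
by apply: continuous_cvg => //; exact: Fc.
Qed.

Lemma right_derivative_cst c t : right_derivative (fun=> c) t 0.
Proof.
by split; under eq_fun do rewrite subrr mulr0; exact: cvg_cst.
Qed.

Lemma right_derivativeD phi psi t c d :
  right_derivative phi t c -> right_derivative psi t d ->
  right_derivative (fun s => phi s + psi s) t (c + d).
Proof.
case=> pc [qd]; split; apply: cvg_trans (cvgD pc qd).
by apply: near_eq_cvg; apply: nearW => h; rewrite fctE; ring.
Qed.

Lemma right_derivativeM phi psi t c d :
  right_derivative phi t c -> right_derivative psi t d ->
  right_derivative (fun s => phi s * psi s) t (c * psi t + phi t * d).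
Proof.
move=> pc qd.
split; apply: cvg_trans (cvgD
  (cvgM (right_derivative_cvg pc) (right_derivative_continuous qd))
  (cvgM (cvg_cst (phi t)) (right_derivative_cvg qd))).
by apply: near_eq_cvg; apply: nearW => h; rewrite fctE /=; ring.
Qed.

Lemma right_derivative_sum (I : Type) (r : seq I) (F : I -> R -> R) t (c : I -> R) :
  (forall i, right_derivative (F i) t (c i)) ->
  right_derivative (fun s => \sum_(i <- r) F i s) t (\sum_(i <- r) c i).
Proof.
move=> Fc; elim: r => [|i r IHr].
  by under eq_fun do rewrite big_nil; rewrite big_nil; exact: right_derivative_cst.
by under eq_fun do rewrite big_cons; rewrite big_cons; exact: right_derivativeD.
Qed.

(** The tangent inequality of the exponential, used at both ends of the increment, squeezes its
    difference quotient between that of [phi] times [expR (phi t)] and times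
    [expR (phi (t + h))]. *)
Lemma right_derivative_exp phi t c : right_derivative phi t c ->
  right_derivative (fun s => expR (phi s)) t (expR (phi t) * c).
Proof.
move=> pc; have pt := right_derivative_continuous pc.
have et : expR (phi (t + h)) @[h --> 0^'+] --> expR (phi t).
  by apply: continuous_cvg => //; exact: continuous_expR.
case: pc => pc; split; apply: (squeeze_cvgr _ (cvgM (cvg_cst _) pc) (cvgM et pc)).
near=> h.
have h0 : 0 < h^-1 by rewrite invr_gt0; near: h; exact: nbhs_right_gt.
have tangent (x y : R) : expR x * (y - x) <= expR y - expR x.
  have := expR_ge1Dx (y - x); rewrite -(ler_pM2l (expR_gt0 x)).
  have <- : expR y = expR x * expR (y - x) by rewrite -expRD addrC subrK.
  by rewrite mulrDr mulr1 lerBrDl.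
rewrite ?fctE /= !(mulrCA _ h^-1) !ler_pM2l// tangent/=.
by have := tangent (phi (t + h)) (phi t); rewrite -(opprB (phi _)) mulrN lerNl opprB.
Unshelve. all: by end_near. Qed.

Lemma cvg_big_sum (T I : Type) (F : set_system T) (r : seq I) (f : I -> T -> R)
    (a : I -> R) : Filter F -> (forall i, f i x @[x --> F] --> a i) ->
  \sum_(i <- r) f i x @[x --> F] --> \sum_(i <- r) a i.
Proof.
move=> FF fa; elim: r => [|i r IHr].
  by under eq_fun do rewrite big_nil; rewrite big_nil; exact: cvg_cst.
by under eq_fun do rewrite big_cons; rewrite big_cons; exact: cvgD.
Qed.

(** The exact identity [B (t + h) - B t = - (B (t + h) *m (A (t + h) - A t) *m B t)] turns right
    continuity of [B] into its right differentiability. *)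
Lemma right_derivative_inverse (m : nat) (A B : R -> 'M[R]_m) t (dA : 'M[R]_m) :
  (forall i j, right_derivative (fun s => A s i j) t (dA i j)) ->
  (forall i j, B (t + h) i j @[h --> 0^'+] --> B t i j) ->
  A t *m B t = 1%:M -> (\forall h \near 0^'+, B (t + h) *m A (t + h) = 1%:M) ->
  forall i j, right_derivative (fun s => B s i j) t ((- (B t *m dA *m B t)) i j).
Proof.
move=> Ad Bc AB BA i j.
have lim : - \sum_q (\sum_p B (t + h) i p * (h^-1 * (A (t + h) p q - A t p q))) * B t q j
    @[h --> 0^'+] --> - \sum_q (\sum_p B t i p * dA p q) * B t q j.
  apply: cvgN; apply: cvg_big_sum => q; apply: cvgM; last exact: cvg_cst.
  by apply: cvg_big_sum => p; apply: cvgM; [exact: Bc|case: (Ad p q)].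
have -> : (- (B t *m dA *m B t)) i j = - \sum_q (\sum_p B t i p * dA p q) * B t q j.
  by rewrite !mxE; congr (- _); apply: eq_bigr => q _; rewrite mxE.
split; apply: cvg_trans lim; apply: near_eq_cvg; near=> h.
have BAh : B (t + h) *m A (t + h) = 1%:M by near: h.
have E : B (t + h) - B t = - (B (t + h) *m (A (t + h) - A t) *m B t).
  by rewrite mulmxBr mulmxBl BAh mul1mx -mulmxA AB mulmx1 opprB.
have -> : B (t + h) i j - B t i j = (B (t + h) - B t) i j by rewrite !mxE.
rewrite E !mxE mulrN mulr_sumr; congr (- _); apply: eq_bigr => q _.
rewrite mulrA !mxE mulr_sumr; congr (_ * _); apply: eq_bigr => p _.
by rewrite !mxE mulrCA.
Unshelve. all: by end_near. Qed.

End right_derivative.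

(** * Entrywise right derivatives of matrix curves *)

Section matrix_curves.
Context (R : realType).

Definition right_derivative_mx (m n : nat) (A : R -> 'M[R]_(m, n)) t (dA : 'M[R]_(m, n)) :=
  forall i j, right_derivative (fun s => A s i j) t (dA i j).

Lemma right_derivative_mxB (m n : nat) (A B : R -> 'M[R]_(m, n)) t dA dB :
  right_derivative_mx A t dA -> right_derivative_mx B t dB ->
  right_derivative_mx (fun s => A s - B s) t (dA - dB).
Proof.
move=> Ad Bd i j; rewrite !mxE; under eq_fun do rewrite !mxE -mulN1r.
apply: right_derivativeD (Ad i j) _.
apply: right_derivative_eq (right_derivativeM (right_derivative_cst (-1) t) (Bd i j)).
by rewrite mul0r add0r mulN1r.
Qed.

Lemma right_derivative_mx_cst (m n : nat) (A : 'M[R]_(m, n)) t :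
  right_derivative_mx (fun=> A) t 0.
Proof. by move=> i j; rewrite mxE; exact: right_derivative_cst. Qed.

Lemma right_derivative_mxMr (m n p : nat) (A : R -> 'M[R]_(m, n)) (B : 'M[R]_(n, p)) t dA :
  right_derivative_mx A t dA ->
  right_derivative_mx (fun s => A s *m B) t (dA *m B).
Proof.
move=> Ad i j; rewrite mxE; under eq_fun do rewrite mxE.
apply: right_derivative_sum => k.
apply: right_derivative_eq (right_derivativeM (Ad i k) (right_derivative_cst (B k j) t)).
by rewrite mulr0 addr0.
Qed.

Lemma right_derivative_dot (m n : nat) (A : R -> 'M[R]_(m, n)) t dA :
  right_derivative_mx A t dA ->
  right_derivative (fun s => dot (A s) (A s)) t (2 * dot (A t) dA).
Proof.
move=> Ad; rewrite /dot mulr_sumr; apply: right_derivative_sum => i.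
rewrite mulr_sumr; apply: right_derivative_sum => j.
apply: right_derivative_eq (right_derivativeM (Ad i j) (Ad i j)); ring.
Qed.

Lemma right_derivative_tr (n : nat) (A : R -> 'M[R]_n) t dA :
  right_derivative_mx A t dA -> right_derivative (fun s => \tr (A s)) t (\tr dA).
Proof. by move=> Ad; apply: right_derivative_sum => i; exact: Ad. Qed.

End matrix_curves.

(** * Extension of the weights off the state space *)

Section symmetrized_weights.
Context (R : realType) (n : nat) (e : rel 'I_n).
Hypothesis e_sym : symmetric e.
Implicit Types a : 'M[R]_n.

(* The storage function must be defined off the state space, where [a] need
   neither be symmetric nor vanish off the edges. *)
Definition symmetrized a : 'M[R]_n :=
  \matrix_(i, q) (if e i q then (a i q + a q i) / 2 else 0).

Lemma symmetrized_tr a : (symmetrized a)^T = symmetrized a.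
Proof. by apply/matrixP => i q; rewrite !mxE e_sym addrC. Qed.

Lemma symmetrized_id a : graph_weights e a -> symmetrized a = a.
Proof.
move=> ga; apply/matrixP => i q; rewrite mxE; have [aE _ a0] := ga i q.
case: ifPn => [_|/a0 ->//]; rewrite -aE; by field.
Qed.

Lemma symmetrized_gt0 a i q : (forall i q, e i q -> 0 < a i q) -> e i q ->
  0 < symmetrized a i q.
Proof.
move=> a0 eiq; rewrite mxE eiq divr_gt0// addr_gt0// a0//.
by rewrite e_sym.
Qed.

Lemma symmetrized_ge0 a i q : (forall i q, e i q -> 0 <= a i q) ->
  0 <= symmetrized a i q.
Proof.
move=> a0; rewrite mxE; case: ifPn => // eiq.
by rewrite divr_ge0// addr_ge0// a0// e_sym.
Qed.

(** Only sums and products appear on the right, so that the rules for C^1 functions and for right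
    derivatives apply directly. *)
Lemma grounded_laplacianE a i q : grounded_laplacian a i q =
  (\sum_p a i p) * (i == q)%:R + -1 * a i q + 1.
Proof. by rewrite !mxE mulr_natr mulN1r. Qed.

Lemma right_derivative_grounded (a : R -> 'M[R]_n) t da :
  right_derivative_mx a t da ->
  right_derivative_mx (fun s => grounded_laplacian (symmetrized (a s))) t
    (laplacian (symmetrized da)).
Proof.
move=> ad.
have sd i q : right_derivative (fun s => symmetrized (a s) i q) t (symmetrized da i q).
  rewrite mxE; under eq_fun do rewrite mxE.
  case: (e i q); last exact: right_derivative_cst.
  apply: right_derivative_eq (right_derivativeM (right_derivativeD (ad i q) (ad q i))
    (right_derivative_cst 2^-1 t)).
  by rewrite mulr0 addr0.
move=> i q.
have -> : laplacian (symmetrized da) i q =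
    (\sum_p symmetrized da i p) *+ (i == q) + -1 * symmetrized da i q.
  by rewrite !mxE mulN1r.
under eq_fun do rewrite grounded_laplacianE.
apply: right_derivative_eq (right_derivativeD (right_derivativeD (right_derivativeM
  (right_derivative_sum _ (fun p => sd i p)) (right_derivative_cst _ t))
  (right_derivativeM (right_derivative_cst _ t) (sd i q))) (right_derivative_cst 1 t)).
by rewrite mulr0 mul0r add0r !addr0 mulr_natr.
Qed.

End symmetrized_weights.

(** * The storage function: sign and regularity *)

Section storage_function.
Context (R : realType) (n l : nat) (e : rel 'I_n).
Variable mg : 'I_n -> 'I_l -> nat.
Hypothesis e_sym : symmetric e.
Hypothesis e_conn : forall i q, connect e i q.
Variables (xs b : 'M[R]_(n, l)) (th : forall i k, 'I_(mg i k) -> R).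

Local Notation Z := (state R n l mg).

Definition ground (z : Z) : 'M[R]_n := grounded_laplacian (symmetrized e (st_a z)).

(** Cramer's formula, without the case distinction of [invmx], with which it agrees on the storage
    domain. *)
Definition ground_inv (z : Z) : 'M[R]_n :=
  (\det (ground z))^-1 *: \adj (ground z).

Definition energy (z : Z) : R :=
  2^-1 * (dot (st_x z - xs) (st_x z - xs) +
    dot (st_alpha z - ground_inv z *m b) (st_alpha z - ground_inv z *m b) +
    \sum_i \sum_k \sum_(j < mg i k) (mult (st_theta z) j - th j) ^+ 2).

(* As the weights grow, the equilibrium value [ground_inv z *m b] of alpha
   drifts; the exponential decreases fast enough to pay for the drift. *)
Definition storage (z : Z) : R :=
  (energy z + dot b b / 2) * expR (\tr (ground_inv z)).

Let D := @storage_domain R n l e mg.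

Lemma energy_ge0 z : 0 <= energy z.
Proof.
rewrite mulr_ge0// !addr_ge0 ?dot_ge0// sumr_ge0// => i _.
by rewrite sumr_ge0// => k _; rewrite sumr_ge0// => j _; rewrite sqr_ge0.
Qed.

Lemma storage_ge0 z : 0 <= storage z.
Proof.
by rewrite mulr_ge0 ?expR_ge0// addr_ge0 ?energy_ge0// divr_ge0 ?dot_ge0.
Qed.

Lemma ground_unit z : D z -> ground z \in unitmx.
Proof.
move=> Dz; apply: (grounded_laplacian_unit e_conn).
- exact: symmetrized_tr.
- by move=> i q; apply: symmetrized_ge0 => // ? ? /Dz/ltW.
- by move=> i q; exact: symmetrized_gt0.
Qed.

Lemma ground_invE z : D z -> ground_inv z = invmx (ground z).
Proof. by move=> Dz; rewrite /invmx ground_unit. Qed.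

Lemma fst_continuous (T U : topologicalType) : continuous (@fst T U).
Proof. by move=> p; exact: cvg_fst. Qed.

Lemma snd_continuous (T U : topologicalType) : continuous (@snd T U).
Proof. by move=> p; exact: cvg_snd. Qed.

Lemma coord_comp_continuous (T : topologicalType) (p q : nat) (f : T -> 'M[R]_(p, q)) i j :
  continuous f -> continuous (fun z => f z i j).
Proof.
move=> fc z; apply: (@continuous_comp _ _ _ f (fun M : 'M[R]_(p, q) => M i j)).
  exact: fc.
exact: coord_continuous.
Qed.

Lemma st_x_continuous : continuous (@st_x R n l mg).
Proof.
move=> z; apply: (@continuous_comp _ _ _ (fun z : Z => z.1.1) fst); last exact: fst_continuous.
by apply: (@continuous_comp _ _ _ fst fst); exact: fst_continuous.
Qed.

Lemma st_a_continuous : continuous (@st_a R n l mg).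
Proof.
move=> z; apply: (@continuous_comp _ _ _ (fun z : Z => z.1.1) snd); last exact: snd_continuous.
by apply: (@continuous_comp _ _ _ fst fst); exact: fst_continuous.
Qed.

Lemma st_alpha_continuous : continuous (@st_alpha R n l mg).
Proof.
move=> z; apply: (@continuous_comp _ _ _ fst snd); last exact: snd_continuous.
exact: fst_continuous.
Qed.

Lemma st_theta_continuous : continuous (@st_theta R n l mg).
Proof. exact: snd_continuous. Qed.

Lemma open_positive_entries (T : topologicalType) (A : T -> 'M[R]_n) :
  continuous A -> open [set w | forall i q, e i q -> 0 < A w i q].
Proof.
move=> Ac; rewrite openE => p Ap; rewrite /interior.
have near_pos i q : \forall w \near p, e i q -> 0 < A w i q.
  have [eiq|neiq] := boolP (e i q); last by near=> w.
  have Aiq : A w i q @[w --> p] --> A p i q by exact: coord_comp_continuous.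
  by move: Aiq => /cvgr_gt/(_ _ (Ap i q eiq)); apply: filterS => w.
by apply: filter_forall => i; apply: filter_forall => q; exact: near_pos.
Unshelve. all: by end_near. Qed.

Lemma storage_domain_open : open (D `*` [set: Z]).
Proof.
have -> : D `*` [set: Z] = [set p : Z * Z | forall i q, e i q -> 0 < st_a p.1 i q].
  by apply/seteqP; split=> [p []|p].
apply: (@open_positive_entries (Z * Z)%type (fun p => st_a p.1)) => p.
by apply: continuous_comp; [exact: fst_continuous|exact: st_a_continuous].
Qed.

(** Storage functions take a pair of state and velocity; those considered here depend on the state
    alone. *)
Let C1 (f : Z -> R) := C1_on (D `*` [set: Z]) (fun p => f p.1).

Lemma C1_state_linear (f : Z -> R) : scalar f -> continuous f -> C1 f.
Proof.
move=> flin fc; apply: (@C1_linear _ _ _ storage_domain_open (fun p => f p.1)).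
  by move=> c p q; rewrite -flin.
move=> p; apply: (@continuous_comp _ _ _ fst f); first exact: fst_continuous.
exact: fc.
Qed.

Lemma scalar_x i k : scalar (fun z : Z => st_x z i k).
Proof. by move=> c z w; rewrite /st_x/= !mxE. Qed.

Lemma scalar_a i k : scalar (fun z : Z => st_a z i k).
Proof. by move=> c z w; rewrite /st_a/= !mxE. Qed.

Lemma scalar_alpha i k : scalar (fun z : Z => st_alpha z i k).
Proof. by move=> c z w; rewrite /st_alpha/= !mxE. Qed.

Lemma scalar_mult i k (j : 'I_(mg i k)) : scalar (fun z : Z => mult (st_theta z) j).
Proof. by move=> c z w; rewrite /mult/st_theta/= !mxE. Qed.

Lemma mult_continuous i k (j : 'I_(mg i k)) :
  continuous (fun z : Z => mult (st_theta z) j).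
Proof. by apply: coord_comp_continuous; exact: st_theta_continuous. Qed.

Let oD := storage_domain_open.

Let C1B f (h : Z -> R) : C1 f -> C1 h -> C1 (fun z => f z - h z).
Proof.
move=> fC hC; apply: (C1_add oD fC).
by under eq_fun do rewrite -mulN1r; apply: (C1_mul oD _ hC); exact: C1_cst.
Qed.

Let C1_dot (A : Z -> 'M[R]_(n, l)) :
  (forall i k, C1 (fun z => A z i k)) -> C1 (fun z => dot (A z) (A z)).
Proof.
by move=> A_C1; apply: (C1_sum oD) => i; apply: (C1_sum oD) => k; apply: (C1_mul oD); exact: A_C1.
Qed.

Lemma C1_ground_inv i q : C1 (fun z => ground_inv z i q).
Proof.
apply: (@C1_adjugate_inverse _ _ _ oD n (fun p => ground p.1)).
  by move=> p [Dp _]; exact: ground_unit.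
have aC i' q' : C1 (fun z => st_a z i' q').
  apply: C1_state_linear; first exact: scalar_a.
  by apply: coord_comp_continuous; exact: st_a_continuous.
have sC i' q' : C1 (fun z => symmetrized e (st_a z) i' q').
  rewrite /C1; under eq_fun do rewrite mxE.
  case: (e i' q'); last exact: C1_cst.
  apply: (C1_mul oD); last exact: C1_cst.
  exact: (C1_add oD (aC i' q') (aC q' i')).
move=> i' q'; under eq_fun do rewrite grounded_laplacianE.
apply: (C1_add oD); last exact: C1_cst.
apply: (C1_add oD); apply: (C1_mul oD); try exact: C1_cst; last exact: sC.
by apply: (C1_sum oD) => p; exact: sC.
Qed.

Lemma C1_storage : C1 storage.
Proof.
have xC i k : C1 (fun z => st_x z i k).
  apply: C1_state_linear; first exact: scalar_x.
  by apply: coord_comp_continuous; exact: st_x_continuous.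
have alphaC i k : C1 (fun z => st_alpha z i k).
  apply: C1_state_linear; first exact: scalar_alpha.
  by apply: coord_comp_continuous; exact: st_alpha_continuous.
have multC i k (j : 'I_(mg i k)) : C1 (fun z => mult (st_theta z) j).
  by apply: C1_state_linear; [exact: scalar_mult|exact: mult_continuous].
have energyC : C1 energy.
  apply: (C1_mul oD); first exact: C1_cst.
  apply: (C1_add oD); first apply: (C1_add oD).
  - apply: (@C1_dot (fun z => st_x z - xs)) => i k.
    rewrite /C1; under eq_fun do rewrite !mxE.
    exact: (@C1B (fun z => st_x z i k) (fun=> xs i k) (xC i k) (C1_cst oD _)).
  - apply: (@C1_dot (fun z => st_alpha z - ground_inv z *m b)) => i k.
    rewrite /C1; under eq_fun do rewrite !mxE.
    apply: (@C1B (fun z => st_alpha z i k) (fun z => \sum_q ground_inv z i q * b q k)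
      (alphaC i k)).
    apply: (C1_sum oD) => q.
    by apply: (C1_mul oD); [exact: C1_ground_inv|exact: C1_cst].
  - apply: (C1_sum oD) => i; apply: (C1_sum oD) => k; apply: (C1_sum oD) => j.
    rewrite /C1; under eq_fun do rewrite expr2.
    have dC := @C1B (fun z => mult (st_theta z) j) (fun=> th j) (multC i k j)
      (C1_cst oD _).
    exact: (C1_mul oD dC dC).
apply: (C1_mul oD); first exact: (C1_add oD energyC (C1_cst oD _)).
by apply: (C1_exp oD); apply: (C1_sum oD) => i; exact: C1_ground_inv.
Qed.

End storage_function.

(** * Right derivative of the storage function along a curve *)

Lemma differentiable_fst_continuous (R : realType) (X : normedModType R)
    (f : X -> R) (x : X) :
  differentiable (fun p : X * X => f p.1) (x, x) -> {for x, continuous f}.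
Proof.
move=> /differentiable_continuous fc.
apply: (@continuous_comp _ _ _ (fun w : X => (w, w)) (fun p : X * X => f p.1)) fc.
by apply: cvg_pair; exact: cvg_id.
Qed.

Lemma differentiable_fst_right_continuous (R : realType) (X : normedModType R)
    (f : X -> R) (z : R -> X) t :
  differentiable (fun p : X * X => f p.1) (z t, z t) ->
  z (t + h) @[h --> 0^'+] --> z t -> f (z (t + h)) @[h --> 0^'+] --> f (z t).
Proof. by move=> /differentiable_fst_continuous fc zc; exact: continuous_cvg. Qed.

Section storage_derivative.
Context (R : realType) (n l : nat) (e : rel 'I_n) (mg : 'I_n -> 'I_l -> nat).
Hypotheses (e_sym : symmetric e) (e_conn : forall i q, connect e i q).
Variables (xs b : 'M[R]_(n, l)) (th : forall i k, 'I_(mg i k) -> R).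

Local Notation Z := (state R n l mg).
Local Notation ground_inv := (@ground_inv R n l e mg).
Local Notation energy := (@energy R n l e mg xs b th).
Local Notation storage := (@storage R n l e mg xs b th).
Local Notation D := (@storage_domain R n l e mg).

Lemma mul_ground_inv z : D z -> ground e z *m ground_inv z = 1%:M.
Proof. by move=> Dz; rewrite ground_invE// mulmxV// ground_unit. Qed.

Lemma ground_inv_mul z : D z -> ground_inv z *m ground e z = 1%:M.
Proof. by move=> Dz; rewrite ground_invE// mulVmx// ground_unit. Qed.

Lemma ground_inv_tr z : D z -> (ground_inv z)^T = ground_inv z.
Proof.
move=> Dz; rewrite ground_invE// trmx_inv; congr invmx.
exact/grounded_laplacian_tr/symmetrized_tr.
Qed.

Variables (z : R -> Z) (t : R) (dz : Z).
Hypothesis zd : h^-1 *: (z (t + h) - z t) @[h --> 0^'+] --> dz.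
Hypothesis Dz : D (z t).

Let zc : z (t + h) @[h --> 0^'+] --> z t.
Proof. exact: right_continuous_curve zd. Qed.

Lemma storage_domain_near : \forall h \near 0^'+, D (z (t + h)).
Proof.
have Dopen : open D.
  apply: (@open_positive_entries R n e _ (@st_a R n l mg)).
  exact: st_a_continuous.
exact: (zc (open_nbhs_nbhs (conj Dopen Dz))).
Qed.

Let P := ground_inv (z t).
Let L := laplacian (symmetrized e (st_a dz)).

Lemma right_derivative_ground_inv :
  right_derivative_mx (fun s => ground_inv (z s)) t (- (P *m L *m P)).
Proof.
apply: (@right_derivative_inverse _ _ (fun s => ground e (z s))).
- apply: (right_derivative_grounded e) => i q.
  apply: (@right_derivative_linear _ _ (fun w : Z => st_a w i q) _ _ _ _ _ zd);
    first exact: scalar_a.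
  by apply: coord_comp_continuous; exact: st_a_continuous.
- move=> i j.
  have [//|Pd _] := @C1_ground_inv R n l e mg e_sym e_conn i j (z t, z t).
  exact: (@differentiable_fst_right_continuous R Z (fun w => ground_inv w i j) z t Pd zc).
- exact: mul_ground_inv.
- by apply: filterS storage_domain_near => h; exact: ground_inv_mul.
Qed.

(** The term [P *m L *m P *m b] is the opposite of the velocity of the moving target
    [ground_inv (z s) *m b] of alpha. *)
Lemma right_derivative_energy : right_derivative (fun s => energy (z s)) t
  (dot (st_x (z t) - xs) (st_x dz) +
   dot (st_alpha (z t) - P *m b) (st_alpha dz + P *m L *m P *m b) +
   \sum_i \sum_k \sum_(j < mg i k)
     (mult (st_theta (z t)) j - th j) * mult (st_theta dz) j).
Proof.
have xd : right_derivative_mx (fun s => st_x (z s) - xs) t (st_x dz - 0).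
  apply: right_derivative_mxB (right_derivative_mx_cst _ _) => i k.
  apply: (@right_derivative_linear _ _ (fun w : Z => st_x w i k) _ _ _ _ _ zd);
    first exact: scalar_x.
  by apply: coord_comp_continuous; exact: st_x_continuous.
have ad : right_derivative_mx (fun s => st_alpha (z s) - ground_inv (z s) *m b) t
    (st_alpha dz - - (P *m L *m P) *m b).
  apply: right_derivative_mxB (right_derivative_mxMr _ right_derivative_ground_inv) => i k.
  apply: (@right_derivative_linear _ _ (fun w : Z => st_alpha w i k) _ _ _ _ _ zd);
    first exact: scalar_alpha.
  by apply: coord_comp_continuous; exact: st_alpha_continuous.
have td : right_derivative (fun s => \sum_i \sum_k \sum_(j < mg i k)
      (mult (st_theta (z s)) j - th j) ^+ 2) t
    (\sum_i \sum_k \sum_(j < mg i k)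
      2 * ((mult (st_theta (z t)) j - th j) * mult (st_theta dz) j)).
  apply: right_derivative_sum => i; apply: right_derivative_sum => k.
  apply: right_derivative_sum => j.
  have md : right_derivative (fun s => mult (st_theta (z s)) j - th j) t
      (mult (st_theta dz) j + 0).
    apply: right_derivativeD (right_derivative_cst _ _).
    apply: (@right_derivative_linear _ _ (fun w : Z => mult (st_theta w) j) _ _ _ _ _ zd);
      first exact: scalar_mult.
    exact: mult_continuous.
  under eq_fun do rewrite expr2.
  by apply: right_derivative_eq (right_derivativeM md md); ring.
have := right_derivativeM (right_derivative_cst 2^-1 t) (right_derivativeD
  (right_derivativeD (right_derivative_dot xd) (right_derivative_dot ad)) td).
apply: right_derivative_eq.
have -> : \sum_i \sum_k \sum_(j < mg i k)
      2 * ((mult (st_theta (z t)) j - th j) * mult (st_theta dz) j) =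
    2 * \sum_i \sum_k \sum_(j < mg i k)
      ((mult (st_theta (z t)) j - th j) * mult (st_theta dz) j).
  rewrite mulr_sumr; apply: eq_bigr => i _; rewrite mulr_sumr.
  by apply: eq_bigr => k _; rewrite mulr_sumr.
by rewrite subr0 mulNmx opprK; field.
Qed.

Lemma right_derivative_storage : right_derivative (fun s => storage (z s)) t
  ((dot (st_x (z t) - xs) (st_x dz) +
    dot (st_alpha (z t) - P *m b) (st_alpha dz + P *m L *m P *m b) +
    \sum_i \sum_k \sum_(j < mg i k)
      (mult (st_theta (z t)) j - th j) * mult (st_theta dz) j -
    (energy (z t) + dot b b / 2) * \tr (P *m L *m P)) * expR (\tr P)).
Proof.
have trd := right_derivative_tr right_derivative_ground_inv.
have := right_derivativeM (right_derivativeD right_derivative_energy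
  (right_derivative_cst (dot b b / 2) t)) (right_derivative_exp trd).
by apply: right_derivative_eq; rewrite linearN/= -/P; ring.
Qed.

(** It suffices to bound the rate of the energy with the target of alpha frozen: since the weights
    do not decrease, the derivative of the exponential absorbs the drift. *)
Lemma storage_rate_le (w : R) : w <= 0 -> (forall i q, e i q -> 0 <= st_a dz i q) ->
  dot (st_x (z t) - xs) (st_x dz) + dot (st_alpha (z t) - P *m b) (st_alpha dz) +
    \sum_i \sum_k \sum_(j < mg i k)
      (mult (st_theta (z t)) j - th j) * mult (st_theta dz) j <= w ->
  exists2 c, right_derivative (fun s => storage (z s)) t c & c <= w.
Proof.
move=> w0 da0 le_w; eexists; first exact: right_derivative_storage.
have sT := symmetrized_tr e_sym (st_a dz).
have s0 i q : 0 <= symmetrized e (st_a dz) i q by exact: symmetrized_ge0.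
have PT : P^T = P by exact: ground_inv_tr.
have drift := dot_inverse_laplacian_le (st_alpha (z t) - P *m b) b sT s0 PT.
have trL : 0 <= \tr (P *m L *m P).
  by rewrite -mulmxA -{1}PT -dot_trace dot_laplacian_ge0.
have trP : 0 <= \tr P.
  apply: (@grounded_inverse_tr_ge0 _ _ (symmetrized e (st_a (z t)))) => //.
  - exact: symmetrized_tr.
  - by move=> i q; apply: symmetrized_ge0 => // ? ? /Dz/ltW.
  - exact: mul_ground_inv.
have exp1 : 1 <= expR (\tr P) by rewrite (le_trans _ (expR_ge1Dx _))// lerDl.
have E_ge : dot (st_alpha (z t) - P *m b) (st_alpha (z t) - P *m b) / 2 <= energy (z t).
  rewrite /energy mulrC ler_pM2l// -addrA addrCA lerDl addr_ge0 ?dot_ge0//.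
  by do 3 (apply: sumr_ge0 => ? _); exact: sqr_ge0.
have drift' : dot (st_alpha (z t) - P *m b) (P *m L *m P *m b) <=
    (energy (z t) + dot b b / 2) * \tr (P *m L *m P).
  by apply: le_trans drift _; rewrite ler_wpM2r// mulrDl lerD2r.
(* The exponential factor multiplies the bound [w] as well; being at least 1, it only lowers a
   nonpositive [w]. *)
apply: (@le_trans _ _ (w * expR (\tr P))).
  rewrite ler_pM2r ?expR_gt0// dotDr; lra.
by rewrite -[leRHS]mulr1 ler_wnM2l.
Qed.

End storage_derivative.

(** * Dissipation at a saddle point *)

Section saddle_point.
Context (R : realType) (n l : nat).
Variables (F : 'M[R]_(n, l) -> R) (g : nat -> R -> R) (mg : 'I_n -> 'I_l -> nat).
Hypothesis n_gt0 : (0 < n)%N.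
Hypothesis F_mono : forall X Y, 0 <= dot (gradient F X - gradient F Y) (X - Y).
Hypothesis g_tangent : forall i k (j : 'I_(mg i k)) x y,
  derive1 (g j) x * (y - x) <= g j y - g j x.
Variables (xs : 'M[R]_(n, l)) (ths : forall i k, 'I_(mg i k) -> R).
Hypothesis xs_consensus : forall i q k, xs i k = xs q k.
Hypothesis xs_feasible : forall i k (j : 'I_(mg i k)), g j (xs i k) <= 0.
Hypothesis ths_ge0 : forall i k (j : 'I_(mg i k)), 0 <= ths j.
Hypothesis ths_slack : forall i k (j : 'I_(mg i k)), ths j * g j (xs i k) = 0.

(** The projection can only help: where it acts, [theta = 0] and [gx <= 0]. Then the two tangent
    inequalities are weighted by [theta] and [theta_s], and complementary slackness removes
    [theta_s * gxs]. *)
Lemma multiplier_rate_le (theta theta_s x x_s gx gxs dgx dgxs : R) :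
  0 <= theta -> 0 <= theta_s -> gxs <= 0 -> theta_s * gxs = 0 ->
  dgx * (x_s - x) <= gxs - gx -> dgxs * (x - x_s) <= gx - gxs ->
  (theta - theta_s) * proj_pos gx theta <=
    (x - x_s) * (theta * dgx - theta_s * dgxs).
Proof.
move=> th0 ths0 gxs0 slack tan1 tan2.
have le1 : (theta - theta_s) * proj_pos gx theta <= (theta - theta_s) * gx.
  rewrite /proj_pos; case: ifPn => //; rewrite negb_or -!leNgt => /andP[th_le gx_le].
  have -> : theta = 0 by apply/le_anti; rewrite th_le th0.
  by rewrite mulr0 sub0r mulNr oppr_ge0 mulr_ge0_le0.
apply: le_trans le1 _.
have := ler_wpM2l th0 tan1; have := ler_wpM2l ths0 tan2.
have : theta * gxs <= 0 by rewrite mulr_ge0_le0.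
lra.
Qed.

(** The exchange terms between [x] and alpha cancel because [L] is symmetric, and [L *m w = b]
    cancels the residual of the optimum. Monotonicity of the gradient and the multiplier estimate
    leave only the Laplacian dissipation. *)
Lemma saddle_dissipation (L : 'M[R]_n) (x alpha w b y ys : 'M[R]_(n, l))
    (theta : forall i k, 'I_(mg i k) -> R) :
  L^T = L -> L *m xs = 0 -> L *m w = b -> (forall k, \sum_i b i k = 0) ->
  (forall i k j, 0 <= theta i k j) ->
  y = \matrix_(i, k) \sum_(j < mg i k) theta i k j * derive1 (g j) (x i k) ->
  ys = \matrix_(i, k) \sum_(j < mg i k) ths j * derive1 (g j) (xs i k) ->
  b = - (gradient F xs + ys) ->
  dot (x - xs) (- gradient F x - L *m x + (- (L *m alpha) - y)) +
    dot (alpha - w) (L *m x) +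
    \sum_i \sum_k \sum_(j < mg i k) (theta i k j - ths j) * proj_pos (g j (x i k)) (theta i k j)
  <= - dot (L *m x) x.
Proof.
move=> LT Lxs Lw b0 th0 yE ysE bE.
have Ldot (A B : 'M[R]_(n, l)) : dot (L *m A) B = dot A (L *m B) by rewrite dot_mull LT.
have xsL (A : 'M[R]_(n, l)) : dot xs (L *m A) = 0 by rewrite -Ldot Lxs dot0l.
have bxs : dot b xs = 0.
  rewrite /dot exchange_big big1// => k _.
  under eq_bigr do rewrite (xs_consensus _ (Ordinal n_gt0)).
  by rewrite -mulr_suml b0 mul0r.
have theta_le : \sum_i \sum_k \sum_(j < mg i k)
    (theta i k j - ths j) * proj_pos (g j (x i k)) (theta i k j) <= dot (x - xs) (y - ys).
  rewrite /dot; apply: ler_sum => i _; apply: ler_sum => k _.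
  rewrite yE ysE !mxE -sumrB mulr_sumr; apply: ler_sum => j _.
  exact: (multiplier_rate_le (th0 _ _ _) (ths_ge0 j) (xs_feasible j) (ths_slack j)
    (g_tangent j _ _) (g_tangent j _ _)).
have mono := F_mono x xs.
have f1 A : dot (x - xs) (L *m A) = dot x (L *m A) by rewrite dotDl dotNl xsL subr0.
have f2 : dot (x - xs) b = dot x b by rewrite dotDl dotNl (dotC xs) bxs subr0.
have f3 : dot (alpha - w) (L *m x) = dot x (L *m alpha) - dot x b.
  by rewrite dotDl dotNl -(Ldot alpha) -(Ldot w) Lw !(dotC _ x).
(* The optimality relation [b = - (gradient F xs + ys)] is inserted, so that gradients and
   constraint terms appear as differences from their values at [xs]. *)
have -> : - gradient F x - L *m x + (- (L *m alpha) - y) =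
    - (gradient F x - gradient F xs) + b - (y - ys) - L *m x - L *m alpha.
  rewrite bE; apply/matrixP => i k.
  move: (L *m x) (L *m alpha) => Lx La; rewrite !mxE; ring.
move: mono theta_le; rewrite dotC.
move: (gradient F x - gradient F xs) (y - ys) => G Y mono theta_le.
rewrite !(dotDr (x - xs)) !(dotNr (x - xs)) !f1 f2 f3 (dotC (L *m x)); lra.
Qed.

End saddle_point.

(** * Separable objectives, and passivity of the network *)

Lemma gradient_objective (R : realType) (n l : nat) (fi : 'I_n -> 'rV[R]_l -> R)
    (X : 'M[R]_(n, l)) i k :
  gradient (objective fi) X i k = 'D_(delta_mx 0 k) (fi i) (row i X).
Proof.
rewrite mxE /derive; set dX := (fun h : R => _); set ds := (fun h : R => _).
suff -> : dX = ds by [].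
apply/funext => h; congr (_ *: _) => /=.
have rowE q : row q (h *: delta_mx i k + X) =
    if q == i then h *: delta_mx 0 k + row i X else row q X.
  apply/rowP => p; rewrite !mxE eq_sym.
  by case: eqVneq => [->|_]; rewrite !mxE ?mulr0 ?add0r ?eqxx.
rewrite /objective (bigD1 i)//= [X in _ - X](bigD1 i)//= rowE eqxx.
rewrite (eq_bigr (fun q => fi q (row q X))); first by rewrite opprD addrACA subrr addr0.
by move=> q /negbTE qi; rewrite rowE qi.
Qed.

(** The slack [eps] makes the bound on the right derivative strict, so it holds for small
    increments; continuity at interior times excludes upward jumps. *)
Lemma derivative_le_right_derivative (R : realType) (T : R) (phi w : R -> R) :
  (forall t, 0 <= t < T -> exists2 c, right_derivative phi t c & c <= w t) ->
  (forall t, 0 < t < T -> {for t, continuous phi}) ->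
  derivative_le T phi w.
Proof.
move=> phid phic t tT eps eps0; split=> [|t0].
  have [c [pc] cw] := phid t tT.
  have /(cvgr_le _ pc) near_le : c < w t + eps by rewrite (le_lt_trans cw)// ltrDl.
  near=> h.
  have h0 : 0 < h by near: h; exact: nbhs_right_gt.
  by rewrite -ler_pdivrMl//; near: h.
have tT' : 0 < t < T by rewrite t0; case/andP: tT.
have := cvg_at_left_filter (phic t tT').
move=> /cvgr_gt/(_ (phi t - eps)); rewrite ltrBlDr ltrDl => /(_ eps0).
by apply: filterS => s /ltW; rewrite lerBlDr.
Unshelve. all: by end_near. Qed.

Theorem proposition2p4 (R : realType) (n l : nat) (n_gt0 : (0 < n)%N)
  (l_gt0 : (0 < l)%N)
  (e : rel 'I_n) (e_sym : symmetric e) (e_irr : irreflexive e)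
  (e_conn : forall i q, connect e i q)
  (d : 'I_n -> 'I_n -> R)
  (d_sym : forall i q, d i q = d q i)
  (d_gt0 : forall i q, e i q -> 0 < d i q)
  (rate_lipschitz : forall i q, e i q -> forall rho : R,
    [lipschitz weight_rate (d i q) p | p in
       [set p : 'rV[R]_l * 'rV[R]_l | `|p| <= rho]])
  (fi : 'I_n -> 'rV[R]_l -> R)
  (fi_diff2 : forall i, twice_differentiable (fi i))
  (fi_sconvex : forall i, strongly_convex (fi i))
  (mu kappa : R) (mu_gt0 : 0 < mu)
  (f_sconvex_smooth : forall X Y : 'M[R]_(n, l),
    mu * dot (X - Y) (X - Y) <=
      dot (gradient (objective fi) X - gradient (objective fi) Y) (X - Y) <=
      kappa * dot (X - Y) (X - Y))
  (g : nat -> R -> R) (mg : 'I_n -> 'I_l -> nat)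
  (g_convex : forall i k (j : 'I_(mg i k)),
    convex_function [set: convex_lmodType R^o] (g j))
  (g_diff : forall i k (j : 'I_(mg i k)) (s : R), derivable (g j) s 1)
  (g_slater : slater g mg)
  (astar : R) (astar_gt1 : 1 < astar) :
  passive (@storage_domain R n l e mg)
    (network_trajectory e d (objective fi) g (mg := mg)).
Proof.
have [X0 [X0c X0lt]] := g_slater.
(* The rows of the Slater point agree, so its first row is strictly feasible for the constraints of
   all agents. *)
have [i k j|s [th [sF th0 slack kkt]]] := @exists_KKT_point R n l n_gt0 fi g mg
    (fun i => (fi_diff2 i).1) fi_sconvex g_convex g_diff (row (Ordinal n_gt0) X0).
  by rewrite mxE (X0c _ i) X0lt.
pose xs : 'M[R]_(n, l) := \matrix_(i, k) s 0 k.
pose ys : 'M[R]_(n, l) := \matrix_(i, k) \sum_j th i k j * derive1 (g j) (xs i k).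
(* The value that [L *m alpha] must take at equilibrium; its column sums vanish by stationarity of
   [s]. *)
pose b := - (gradient (objective fi) xs + ys).
have xsE i k : xs i k = s 0 k by rewrite mxE.
have b0 k : \sum_i b i k = 0.
  apply/eqP; rewrite -oppr_eq0 -sumrN; apply/eqP; rewrite -[RHS](kkt k).
  apply: eq_bigr => i _; have sE : row i xs = s by apply/rowP => p; rewrite !mxE.
  rewrite /b mxE opprK mxE gradient_objective sE mxE; congr (_ + _).
  by apply: eq_bigr => j _; rewrite xsE.
have F_mono X Y : 0 <= dot (gradient (objective fi) X - gradient (objective fi) Y) (X - Y).
  have /andP[+ _] := f_sconvex_smooth X Y; apply: le_trans.
  by rewrite mulr_ge0 ?dot_ge0// ltW.
exists (fun p => storage e xs b th p.1); split.
- exact: C1_storage.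
- by move=> z v _; exact: storage_ge0.
move=> T z dz ux y [zc traj]; apply: derivative_le_right_derivative => t tT.
  have [[ga theta0] zd [u1 [y1 [u2 [y2 [u3 [y3 [sys wires]]]]]]] uxE] := traj t tT.
  case: sys => -[dxE daE y1E] [dalphaE y2E] [dthetaE y3E].
  case: wires => u1E u2E u3E yE.
  have Dz : storage_domain e (z t) by move=> i q; have [_ + _] := ga i q.
  have sym_id := symmetrized_id ga.
  pose L := laplacian (st_a (z t)).
  have aT : (st_a (z t))^T = st_a (z t).
    by apply/matrixP => i q; rewrite mxE; have [] := ga q i.
  have a_ge0 i q : 0 <= st_a (z t) i q.
    by have [_ pos zero] := ga i q; case: (boolP (e i q)) => [/pos/ltW|/zero ->].
  have LT : L^T = L by exact: laplacian_tr.
  (* With this input the supply rate is minus the Laplacian form, hence nonpositive, as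
     [storage_rate_le] requires. *)
  have supply : dot (ux t) (y t) = - dot (L *m st_x (z t)) (st_x (z t)).
    by rewrite uxE yE y1E dotNl.
  apply: (storage_rate_le e_sym e_conn zd Dz).
  - by rewrite supply dotC oppr_le0 dot_laplacian_ge0.
  - move=> i q eiq; rewrite daE// mulr_ge0 ?addr_ge0 ?dot_ge0//.
    exact/ltW/d_gt0.
  (* On the state space symmetrization leaves the weights unchanged, so [ground_inv] inverts the
     actual grounded Laplacian. *)
  have Lw : L *m (ground_inv e (z t) *m b) = b.
    apply: laplacian_solve => //; rewrite mulmxA -[st_a (z t)]sym_id.
    by rewrite mul_ground_inv// mul1mx.
  have dxE' : st_x (dz t) = - gradient (objective fi) (st_x (z t)) - L *m st_x (z t) +
      (- (L *m st_alpha (z t)) - y3).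
    by rewrite dxE u1E y2E uxE.
  have dalphaE' : st_alpha (dz t) = L *m st_x (z t) by rewrite dalphaE u2E y1E.
  rewrite supply dxE' dalphaE'.
  have -> : \sum_i \sum_k \sum_(j < mg i k)
        (mult (st_theta (z t)) j - th i k j) * mult (st_theta (dz t)) j =
      \sum_i \sum_k \sum_(j < mg i k)
        (mult (st_theta (z t)) j - th i k j) *
          proj_pos (g j (st_x (z t) i k)) (mult (st_theta (z t)) j).
    do 3 (apply: eq_bigr => ? _); by rewrite dthetaE u3E y1E.
  apply: (@saddle_dissipation R n l (objective fi) g mg n_gt0 F_mono _ xs th
    _ _ th0 _ L _ _ _ b y3 ys (fun i k j => mult (st_theta (z t)) j)) => //.
  - by move=> i k j p r; apply: convex_function_tangent; [exact: g_convex|exact: g_diff].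
  - by move=> i q k; rewrite !xsE.
  - by move=> i k j; rewrite xsE.
  - by move=> i k j; rewrite xsE.
  - by apply: laplacian_consensus => i q k; rewrite !xsE.
  - by rewrite y3E u3E y1E.
have Dz : storage_domain e (z t).
  have /andP[t0 t1] := tT.
  have [|[ga _] _ _ _] := traj t; first by rewrite ltW.
  by move=> i q; have [_ + _] := ga i q.
(* The second [z t] merely fills the velocity slot, on which the storage function does not
   depend. *)
have [//|Vd _] := @C1_storage R n l e mg e_sym e_conn xs b th (z t, z t).
have zt : {for t, continuous z}.
  have : {within `]0, T[, continuous z}.
    by apply: continuous_subspaceW zc; apply: subset_itvW.
  rewrite continuous_open_subspace; last exact: interval_open.
  by apply; rewrite inE/= in_itv.
apply: (@continuous_comp _ _ _ z (storage e xs b th)) => //.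
exact: (differentiable_fst_continuous Vd).
Qed.
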